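(* Let $p_1,p_2,p_3$ be distinct prime numbers with $p_i\equiv 1\pmod 4$ $(i=1,2,3)$, $\left(\frac{p_i}{p_j}\right)=1$ for all $1\le i\ne j\le3$, and $[p_i,p_j,p_k]=1$ for every permutation $(i,j,k)$ of $(1,2,3)$. Let $k=\mathbb{Q}(\sqrt{p_1})$, let $\mathfrak{p}_2$ be a prime of $\mathcal{O}_k$ over $p_2$, and let $\alpha=x+y\sqrt{p_1}$ with $x,y,z\in\mathbb{Z}$, $x^2-p_1y^2-p_2z^2=0$, $\gcd(x,y,z)=1$, $y\equiv0\pmod2$, $x-y\equiv1\pmod4$, $(\alpha)=\mathfrak{p}_2^m$ with $m$ odd positive. Let $k_{13}=\mathbb{Q}(\sqrt{p_1},\sqrt{p_3})$ and $k'_{13}=\mathbb{Q}(\sqrt{p_1},\sqrt{\alpha})$. Assume that the class number of $k$ is $1$ and $p_1\equiv5\pmod8$. Then there exist $X,Y,Z\in\mathcal{O}_k$ such that $X^2-p_3Y^2-\alpha Z^2=0$, $\gcd(X,Y,Z)=1$, and one of the following holds: (A) $Z$ is prime to $2$ (i.e. the ideals $(Z)$ and $(2)$ of $\mathcal O_k$ are coprime) and there is $\lambda\in\mathcal{O}_{k_{13}}$ with $\lambda^2\equiv X+Y\sqrt{p_3}\bmod (4)$; or (B) $Y$ is prime to $2$ and there is $\lambda\in\mathcal{O}_{k'_{13}}$ with $\lambda^2\equiv X+Z\sqrt{\alpha}\bmod(4)$.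
   Context: The Rédei triple symbol $[p,q,r]$ is $1$ if $r$ splits completely in the Rédei extension $k_{\{p,q\}}=\mathbb{Q}(\sqrt p,\sqrt q,\sqrt{x+y\sqrt p})$ (with $x,y,z\in\mathbb{Z}$, $x^2-py^2-qz^2=0$, $\gcd(x,y,z)=1$, $y$ even, $x-y\equiv1\pmod4$; independent of these choices), and $-1$ otherwise. The congruences mod $(4)$ are in the respective rings of integers $\mathcal O_{k_{13}}$, $\mathcal O_{k'_{13}}$. *)

(* Defs.v *)
From HB Require Import structures.
From mathcomp Require Import all_boot all_order all_algebra all_field.
From mathcomp Require Import boolp classical_sets.

Set Implicit Arguments.
Unset Strict Implicit.
Unset Printing Implicit Defensive.

Import Order.TTheory GRing.Theory Num.Theory.
Local Open Scope ring_scope.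
Local Open Scope classical_set_scope.

(* Number fields, their rings of integers and the ideals of these are all     *)
(* represented as subsets of algC. Where a ring is needed, it is passed as    *)
(* the set O.                                                                 *)

(* Q(s), as the intersection of the subfields of algC containing s. *)
Definition Qadjoin (s : seq algC) : set algC :=
  [set x | forall F : {pred algC},
     divring_closed F -> {subset s <= F} -> x \in F].

Definition integers_of (K : set algC) : set algC := [set x | K x /\ x \in Aint].

Definition dvd_in (O : set algC) (d x : algC) : Prop :=
  exists2 c, O c & x = c * d.

Definition congr_mod (O : set algC) (m x y : algC) : Prop :=
  dvd_in O m (x - y).

Definition gcd3_eq1 (O : set algC) (x y z : algC) : Prop :=
  forall d, O d -> dvd_in O d x -> dvd_in O d y -> dvd_in O d z -> dvd_in O d 1.

Definition is_ideal (O I : set algC) : Prop :=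
  [/\ I `<=` O, I 0,
      forall x y, I x -> I y -> I (x + y)
    & forall a x, O a -> I x -> I (a * x)].

Definition principal (O : set algC) (a : algC) : set algC :=
  [set x | dvd_in O a x].

Definition idealD (I J : set algC) : set algC :=
  [set x | exists a b, [/\ I a, J b & x = a + b]].

Definition idealM (I J : set algC) : set algC :=
  [set x | exists2 s : seq (algC * algC),
     (forall u, u \in s -> I u.1 /\ J u.2) & x = \sum_(u <- s) u.1 * u.2].

Definition idealX (O I : set algC) (m : nat) : set algC := iter m (idealM I) O.

Definition coprime_ideals (O I J : set algC) : Prop := idealD I J = O.

Definition prime_ideal (O P : set algC) : Prop :=
  [/\ is_ideal O P, ~ P 1
    & forall a b, O a -> O b -> P (a * b) -> P a \/ P b].

(* The second clause is P \cap Z = qZ. *)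
Definition prime_over (O P : set algC) (q : nat) : Prop :=
  prime_ideal O P /\ forall n : int, P n%:~R <-> (q%:Z %| n)%Z.

Definition nonzero_ideal (O I : set algC) : Prop :=
  is_ideal O I /\ exists2 x, I x & x != 0.

(* I and J lie in the same ideal class: aI = bJ for some nonzero a, b in O. *)
Definition same_class (O I J : set algC) : Prop :=
  exists a b, [/\ O a, O b, a != 0, b != 0
    & [set a * x | x in I] = [set b * x | x in J]].

(* C enumerates, without repetition, representatives of the ideal classes. *)
Definition class_number (K : set algC) (h : nat) : Prop :=
  let O := integers_of K in
  exists C : 'I_h -> set algC,
    [/\ forall i, nonzero_ideal O (C i),
        forall i j, same_class O (C i) (C j) -> i = j
      & forall I, nonzero_ideal O I -> exists i, same_class O I (C i)].

Definition ramification_index (O P : set algC) (r e : nat) : Prop :=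
  idealX O P e r%:R /\ ~ idealX O P e.+1 r%:R.

(* b reduces to a basis of O/P over Z/rZ; scalars are lifted to Z. *)
Definition residue_degree (O P : set algC) (r f : nat) : Prop :=
  exists b : 'I_f -> algC,
    [/\ forall i, O (b i),
        forall x, O x -> exists c : 'I_f -> int,
          P (x - \sum_i (c i)%:~R * b i)
      & forall c : 'I_f -> int, P (\sum_i (c i)%:~R * b i) ->
          forall i, (r%:Z %| c i)%Z].

Definition splits_completely (r : nat) (K : set algC) : Prop :=
  let O := integers_of K in
  forall P, prime_over O P r ->
    ramification_index O P r 1 /\ residue_degree O P r 1.

Definition legendre (a p : nat) : int :=
  if (p %| a)%N then 0
  else if [exists x : 'I_p, x ^ 2 == a %[mod p]] then 1 else -1.

Definition redei_solution (p q : nat) (x y z : int) : Prop :=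
  [/\ x ^+ 2 - p%:Z * y ^+ 2 - q%:Z * z ^+ 2 = 0,
      gcdz (gcdz x y) z = 1,
      (2 %| y)%Z
    & (x - y = 1 %[mod 4])%Z].

Definition redei_alpha (p : nat) (x y : int) : algC :=
  x%:~R + y%:~R * sqrtC p%:R.

Definition redei_field (p q : nat) (x y : int) : set algC :=
  Qadjoin [:: sqrtC p%:R; sqrtC q%:R; sqrtC (redei_alpha p x y)].

(* redei_field does not depend on the solution (x, y, z), so that the         *)
(* existential quantifier amounts to fixing an arbitrary one.                 *)
Definition redei_symbol (p q r : nat) : int :=
  if `[< exists x y z : int, redei_solution p q x y z /\
           splits_completely r (redei_field p q x y) >] then 1 else -1.

(* Main.v *)
(* Let K = k(sqrt p3). Solving X^2 - p3 Y^2 = alpha Z^2 over k amounts to showing that alpha is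
   a norm from K. If u^2 - p3 v^2 = p2 w^2 and beta = u + v sqrt p3, then w alpha and z beta have
   the same norm over Q, and N_{K/k}(w alpha + z beta) = alpha n with n = 2w(xw + uz) rational, so
   it suffices that n is a norm from K. A prime l dividing n to an odd power has p3 or p1 p3 as a
   square mod l. In the first case l is a norm from Q(sqrt p3) by reciprocity and Legendre's
   theorem. The product B of the other primes satisfies chi_{p1}(B) = chi_{p3}(B) = chi_{p3}(n),
   and chi_{p3}(n) = 1 because [p1, p2, p3] = 1 makes alpha a square modulo a prime above p3; by
   Legendre's theorem B is then a norm from Q(sqrt (p1 p3)).

   The class number being one, the solution can be made primitive. As 2 is inert in k and
   p3 = alpha = 1 mod 4, exactly one of Y and Z is even. If Y = 2Y', then
   X + Y sqrt p3 = X - Y mod 4, and multiplying by a unit of k makes X - Y a square mod 4: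
   -1 and a unit of norm -1 generate (O_k/4)^* modulo squares. The other case is symmetric. *)
Require Import Defs.
From HB Require Import structures.
From mathcomp Require Import all_boot all_order all_algebra all_field.
From mathcomp Require Import all_solvable.
From mathcomp Require Import boolp classical_sets.
From mathcomp Require Import zify ring lra.

Set Implicit Arguments.
Unset Strict Implicit.
Unset Printing Implicit Defensive.

Import Order.TTheory GRing.Theory Num.Theory.
Local Open Scope ring_scope.
Local Open Scope classical_set_scope.

(** * Legendre's theorem *)

(** The formula for n is a general fact: if a in k and b in Q(sqrt p3) have the same rational norm,
    then N_{K/k}(a + b) = a^2 + a Tr(b) + N(a) = a (Tr(a) + Tr(b)). The sign of u remains free, and
    one of its two choices makes n prime to p3, so that chi_{p3}(n) can be evaluated. Primes with p1
    p3 a square are within reach because sqrt p1 lies in k: a rational solution of X^2 = p1 p3 Y^2 +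
    B Z^2 exhibits B as a norm from K to k. The main obstacle is that the symbol only provides
    splitting in the field of some solution (x', y', z'), not of the given one. So sqrt alpha has to
    be located inside that other field. This uses that no prime but p2 divides z, which is where
    (alpha) being a power of a prime above p2 enters. Class number one serves a second time in the
    construction of a unit of norm -1, as a square root of a principal ideal. *)

Lemma pigeonhole (A B : finType) (f : A -> B) :
  (#|B| < #|A|)%N -> exists x y, x != y /\ f x = f y.
Proof.
move=> ltBA; have /injectivePn[x [y nexy eqf]] : ~~ injectiveb f.
  by apply/negP => /injectiveP/leq_card; rewrite leqNgt ltBA.
by exists x, y.
Qed.

Lemma floor_sqrt (n : nat) : exists r : nat, (r ^ 2 <= n)%N /\ (n < r.+1 ^ 2)%N.
Proof.
elim: n => [|n [r [h1 h2]]]; first by exists 0%N.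
have [h|h] := ltnP n.+1 (r.+1 ^ 2); last by exists r.+1; split=> //; lia.
by exists r; split=> //; lia.
Qed.

Definition residue_ord (m : nat) (c : int) : 'I_m.+1 := inord `|(c %% m.+1%:Z)%Z|%N.

Lemma residue_ord_inj (m : nat) (c d : int) :
  residue_ord m c = residue_ord m d -> (m.+1%:Z %| c - d)%Z.
Proof.
have lt e : (`|(e %% m.+1%:Z)%Z| < m.+1)%N.
  by have := modz_ge0 e (isT : m.+1%:Z != 0); have := ltz_mod e (isT : m.+1%:Z != 0); lia.
move=> /(congr1 (@nat_of_ord _)); rewrite !inordK // => eqcd.
have := modz_ge0 c (isT : m.+1%:Z != 0); have := modz_ge0 d (isT : m.+1%:Z != 0).
by rewrite -eqz_mod_dvd => ? ?; apply/eqP; lia.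
Qed.

Lemma sqrz_mul_square (a : nat) (x y : int) :
  y != 0 -> x ^+ 2 = a%:Z * y ^+ 2 -> exists r : nat, a = (r ^ 2)%N.
Proof.
move=> y0 e.
have e' : (`|x| ^ 2 = a * `|y| ^ 2)%N by rewrite -!abszX -[X in (X * _)%N]/`|a%:Z|%N -abszM e.
have /dvdnP[r er] : (`|y| %| `|x|)%N by rewrite -(@dvdn_pexp2r _ _ 2) // e' dvdn_mull.
exists r; move: e'; rewrite er expnMn => /eqP; rewrite eqn_pmul2r; last by lia.
by move/eqP.
Qed.

Lemma sqrz_dist_ord (n : nat) (u v : 'I_n.+1) : (u%:Z - v%:Z) ^+ 2 <= n%:Z ^+ 2.
Proof. by have := ltn_ord u; have := ltn_ord v; nia. Qed.

(** The bounds confine the form to the interval from -2AB (excluded) to AB (included), so q is -1, 0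
    or 1, and the value AB leaves no room for y and z. *)
Lemma legendre_form_range (A B q x y z : int) : 0 < A -> 0 < B ->
  x ^+ 2 <= A * B -> y ^+ 2 < B -> z ^+ 2 < A ->
  x ^+ 2 - A * y ^+ 2 - B * z ^+ 2 = q * (A * B) ->
  [\/ q = 0, q = -1 | [/\ y = 0, z = 0 & x ^+ 2 = A * B]].
Proof.
move=> A0 B0 hx hy hz e.
have AB0 : 0 < A * B by rewrite mulr_gt0.
have hy' : A * y ^+ 2 < A * B by rewrite ltr_pM2l.
have hz' : B * z ^+ 2 < A * B by rewrite mulrC ltr_pM2r.
have hy0 : 0 <= A * y ^+ 2 by rewrite mulr_ge0 ?sqr_ge0 ?ltW.
have hz0 : 0 <= B * z ^+ 2 by rewrite mulr_ge0 ?sqr_ge0 ?ltW.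
have hx0 : 0 <= x ^+ 2 by rewrite sqr_ge0.
have q2 : -2 < q.
  rewrite ltNge; apply/negP => q2.
  have : q * (A * B) <= -2 * (A * B) by rewrite ler_pM2r.
  by rewrite -e; lra.
have [q1|q1] := lerP 1 q; last first.
  by have [->|->] : q = 0 \/ q = -1 by [clear -q1 q2; lia|]; [constructor 1|constructor 2].
constructor 3.
have {}q1 : 1 * (A * B) <= q * (A * B) by rewrite ler_pM2r.
rewrite mul1r in q1.
have y0 : A * y ^+ 2 = 0 by lra.
have z0 : B * z ^+ 2 = 0 by lra.
split; last by lra.
- by move/eqP: y0; rewrite mulf_eq0 gt_eqF //= sqrf_eq0 => /eqP.
- by move/eqP: z0; rewrite mulf_eq0 gt_eqF //= sqrf_eq0 => /eqP.
Qed.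

Lemma eqz_sqr_nat (a : nat) (z : int) : z ^+ 2 = a%:Z -> exists r : nat, a = (r ^ 2)%N.
Proof. by exists `|z|%N; lia. Qed.

(** The congruences make x^2 - a y^2 - b z^2 divisible by ab, and the bounds leave only the values
    0, -ab and ab. The first is a solution, the second is turned into one by composition of norm
    forms, the third is impossible. *)
Lemma small_solution_legendre (a b : nat) (s t x y z : int) :
  (0 < a)%N -> (0 < b)%N -> coprime a b ->
  ~ (exists r : nat, a = (r ^ 2)%N) -> ~ (exists r : nat, b = (r ^ 2)%N) ->
  (a%:Z %| s ^+ 2 - b%:Z)%Z -> (b%:Z %| t ^+ 2 - a%:Z)%Z ->
  (a%:Z %| x - s * z)%Z -> (b%:Z %| x - t * y)%Z -> ~ [/\ x = 0, y = 0 & z = 0] ->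
  x ^+ 2 <= a%:Z * b%:Z -> y ^+ 2 <= b%:Z -> z ^+ 2 <= a%:Z ->
  exists x y z : int, z != 0 /\ x ^+ 2 = a%:Z * y ^+ 2 + b%:Z * z ^+ 2.
Proof.
move=> a_gt0 b_gt0 cop nsqa nsqb sb ta e1 e2 xyz0 xX yY zZ.
pose F := x ^+ 2 - a%:Z * y ^+ 2 - b%:Z * z ^+ 2.
have copz : coprimez a%:Z b%:Z by rewrite /coprimez /= -[_ == _]/(gcdn a b == 1%N).
have : (a%:Z * b%:Z %| F)%Z.
  rewrite Gauss_dvdz //; apply/andP; split.
    have -> : F = (x - s * z) * (x + s * z) + (s ^+ 2 - b%:Z) * z ^+ 2 - a%:Z * y ^+ 2
      by rewrite /F; ring.
    by rewrite rpredB ?dvdz_mulr // rpredD ?dvdz_mulr.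
  have -> : F = (x - t * y) * (x + t * y) + (t ^+ 2 - a%:Z) * y ^+ 2 - b%:Z * z ^+ 2
    by rewrite /F; ring.
  by rewrite rpredB ?dvdz_mulr // rpredD ?dvdz_mulr.
case/dvdzP=> q Fq.
have y2b : y ^+ 2 < b%:Z.
  by rewrite lt_neqAle yY andbT; apply/eqP => /eqz_sqr_nat.
have z2a : z ^+ 2 < a%:Z.
  by rewrite lt_neqAle zZ andbT; apply/eqP => /eqz_sqr_nat.
have [q0|q0|[y0 z0 xab]] := legendre_form_range (a_gt0 : 0 < a%:Z) (b_gt0 : 0 < b%:Z) xX y2b z2a Fq.
- exists x, y, z; move: Fq; rewrite /F q0 mul0r => /eqP.
  rewrite subr_eq0 subr_eq => /eqP e; split; last by rewrite e addrC.
  apply/eqP => z0; rewrite z0 expr0n /= mulr0 add0r in e.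
  have [y0|y0] := eqVneq y 0; last by apply: nsqa; apply: (sqrz_mul_square y0 e).
  by apply: xyz0; split=> //; apply/eqP; rewrite -sqrf_eq0 e y0 expr0n mulr0.
- (* (ay + xz)^2 - a(x + yz)^2 = (x^2 - ay^2)(z^2 - a), and here x^2 - ay^2 = b(z^2 - a). *)
  exists (a%:Z * y + x * z), (x + y * z), (z ^+ 2 - a%:Z); split.
    by rewrite subr_eq0 lt_eqF.
  have e : x ^+ 2 - a%:Z * y ^+ 2 = b%:Z * (z ^+ 2 - a%:Z).
    by move: Fq; rewrite /F q0 => /eqP; rewrite subr_eq => /eqP ->; ring.
  have -> : b%:Z * (z ^+ 2 - a%:Z) ^+ 2 = (b%:Z * (z ^+ 2 - a%:Z)) * (z ^+ 2 - a%:Z) by ring.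
  by rewrite -e; ring.
(* In the remaining case x^2 = ab while ab divides x, so ab = 1 and a would be the square 1. *)
rewrite y0 z0 !mulr0 !subr0 in e1 e2.
have /dvdzP[c xc] : (a%:Z * b%:Z %| x)%Z by rewrite Gauss_dvdz // e1.
have M0 : a%:Z * b%:Z != 0 by rewrite mulf_neq0 // gt_eqF.
have : c ^+ 2 * (a%:Z * b%:Z) = 1.
  by apply: (mulIf M0); rewrite mul1r -[RHS]xab xc; ring.
move=> e; case: nsqa; exists 1%N; rewrite exp1n; apply/eqP; rewrite -dvdn1.
have : (a%:Z %| c ^+ 2 * (a%:Z * b%:Z))%Z by rewrite mulrCA dvdz_mulr.
by rewrite e dvdzE.
Qed.

(** A pigeonhole argument: the box with sides floor(sqrt(ab)), floor(sqrt b), floor(sqrt a) has more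
    than ab points, so two of them agree in x - s z mod a and in x - t y mod b; their difference is
    the small vector required. If b = r^2, then (r, 0, 1) is a solution. *)
Lemma legendre_solvable (a b : nat) (s t : int) :
  (0 < a)%N -> (0 < b)%N -> coprime a b -> ~ (exists r : nat, a = (r ^ 2)%N) ->
  (a%:Z %| s ^+ 2 - b%:Z)%Z -> (b%:Z %| t ^+ 2 - a%:Z)%Z ->
  exists x y z : int, z != 0 /\ x ^+ 2 = a%:Z * y ^+ 2 + b%:Z * z ^+ 2.
Proof.
move=> a_gt0 b_gt0 cop nsqa sb ta.
have [[r ->]|nsqb] := pselect (exists r : nat, b = (r ^ 2)%N).
  by exists r%:Z, 0, 1; split=> //; lia.
have [X [X1 X2]] := floor_sqrt (a * b)%N.
have [Y [Y1 Y2]] := floor_sqrt b.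
have [Z [Z1 Z2]] := floor_sqrt a.
(* The bounds are on squares, so the squares are compared: (ab)^2 = (ab) (b a). *)
have box : (a * b < X.+1 * Y.+1 * Z.+1)%N.
  rewrite -(@ltn_exp2r _ _ 2) // !expnMn.
  have -> : (a ^ 2 * b ^ 2 = (a * b) * (b * a))%N by lia.
  by rewrite -(mulnA (_ ^ 2)%N); apply: ltn_mul => //; apply: ltn_mul.
(* The modulus of [residue_ord m] is m + 1, hence the predecessors of a and b. *)
pose f (u : 'I_X.+1 * 'I_Y.+1 * 'I_Z.+1) : 'I_a.-1.+1 * 'I_b.-1.+1 :=
  (residue_ord a.-1 (u.1.1%:Z - s * u.2%:Z), residue_ord b.-1 (u.1.1%:Z - t * u.1.2%:Z)).
have [|[[u1 u2] u3] [[[v1 v2] v3] [neuv]]] := @pigeonhole _ _ f.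
  by rewrite !card_prod !card_ord !prednK.
rewrite /f /= => -[/residue_ord_inj e1 /residue_ord_inj e2].
rewrite !prednK // in e1 e2.
pose x := u1%:Z - v1%:Z; pose y := u2%:Z - v2%:Z; pose z := u3%:Z - v3%:Z.
have {}e1 : (a%:Z %| x - s * z)%Z
  by rewrite [X in (_ %| X)%Z](_ : _ = u1%:Z - s * u3%:Z - (v1%:Z - s * v3%:Z)) // /x /z; ring.
have {}e2 : (b%:Z %| x - t * y)%Z
  by rewrite [X in (_ %| X)%Z](_ : _ = u1%:Z - t * u2%:Z - (v1%:Z - t * v2%:Z)) // /x /y; ring.
have xyz0 : ~ [/\ x = 0, y = 0 & z = 0].
  case; rewrite /x /y /z => h1 h2 h3; move/eqP: neuv; apply.
  by congr (_, _, _); apply: val_inj => /=; [clear -h1|clear -h2|clear -h3]; lia.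
have xX : x ^+ 2 <= a%:Z * b%:Z by apply: le_trans (sqrz_dist_ord u1 v1) _; clear -X1; lia.
have yY : y ^+ 2 <= b%:Z by apply: le_trans (sqrz_dist_ord u2 v2) _; clear -Y1; lia.
have zZ : z ^+ 2 <= a%:Z by apply: le_trans (sqrz_dist_ord u3 v3) _; clear -Z1; lia.
exact: (small_solution_legendre a_gt0 b_gt0 cop nsqa nsqb sb ta e1 e2 xyz0 xX yY zZ).
Qed.

(** * Quadratic characters, Gauss sums and reciprocity *)

Lemma finField_prim_root (F : finFieldType) :
  exists g : F, (#|F|.-1).-primitive_root g.
Proof.
have F1 : (1 < #|F|)%N := finNzRing_gt1 F.
have F0 : (0 < #|F|.-1)%N by case: #|F| F1 => [|[]].
pose rs := [seq x <- enum F | x != 0].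
have /hasP[g _ pg] : has (#|F|.-1).-primitive_root rs.
  apply: has_prim_root => //.
  - apply/allP => x; rewrite mem_filter => /andP[x0 _]; apply/unity_rootP.
    by apply: (mulIf x0); rewrite -exprSr prednK ?expf_card ?mul1r //; apply: ltnW.
  - by rewrite filter_uniq // enum_uniq.
  have -> : size rs = #|[pred x : F | x != 0]|.
    by rewrite cardE /rs {2}/enum_mem -enumT; congr size; apply: eq_filter.
  by have := cardC1 (0 : F); rewrite /predC1 => <-.
by exists g.
Qed.

(** By Euler's theorem N divides l^phi(N) - 1, the order of the multiplicative group of the field
    with l^phi(N) elements. Gauss sums are formed in this field, where the l-th power map is an
    automorphism. *)
Lemma prim_root_exists_pchar (l N : nat) : prime l -> (0 < N)%N -> coprime l N ->
  exists (L : finFieldType) (z : L), l \in [pchar L] /\ N.-primitive_root z.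
Proof.
move=> pl N0 cop.
have [L pL cL] := pPrimePowerField pl (etrans (totient_gt0 N) N0).
have [g pg] := finField_prim_root L.
have dN : (N %| #|L|.-1)%N.
  rewrite cL -subn1 -eqn_mod_dvd ?expn_gt0 ?prime_gt0 //.
  by rewrite Euler_exp_totient.
by exists L, (g ^+ (#|L|.-1 %/ N)); split=> //; apply: dvdn_prim_root.
Qed.

Section QuadraticCharacter.
Variables (p : nat) (p_pr : prime p) (p_mod4 : (p = 1 %[mod 4])%N).

Let p_odd : odd p.
Proof. by move: p_mod4; lia. Qed.

Let pE : p.-1 = (p./2 * 2)%N.
Proof. by move: p_odd; lia. Qed.

Let p2_odd : ~~ odd p./2.
Proof. by move: p_mod4; lia. Qed.

Lemma Fp_prim_root : exists g : 'F_p, p.-1.-primitive_root g.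
Proof. by have := finField_prim_root 'F_p; rewrite card_Fp. Qed.

Lemma Fp_expf_pred (x : 'F_p) : x != 0 -> x ^+ p.-1 = 1.
Proof.
move=> x0; apply: (mulIf x0); rewrite -exprSr mul1r prednK ?prime_gt0 //.
by have := expf_card x; rewrite card_Fp.
Qed.

Lemma Fp_expf_half (x : 'F_p) : x != 0 -> x ^+ p./2 = 1 \/ x ^+ p./2 = -1.
Proof.
move=> /Fp_expf_pred; rewrite pE exprM => /eqP.
by rewrite sqrf_eq1 => /orP[]/eqP; [left|right].
Qed.

Lemma Fp_square_half (x : 'F_p) : x != 0 -> x ^+ p./2 = 1 -> exists y, x = y ^+ 2.
Proof.
move=> x0 hx; have [g pg] := Fp_prim_root.
have [[i /= _] ei] := prim_rootP pg (Fp_expf_pred x0).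
have : (p.-1 %| i * p./2)%N by rewrite (prim_order_dvd pg) exprM -ei hx.
rewrite pE [(i * _)%N]mulnC dvdn_pmul2l; last by have := prime_gt1 p_pr; lia.
by case/dvdnP=> j ej; exists (g ^+ j); rewrite ei ej exprM.
Qed.

Lemma Fp_intr_eq0 (a : int) : (a%:~R == 0 :> 'F_p) = (p%:Z %| a)%Z.
Proof.
rewrite dvdzE /=; case: a => n.
  by rewrite -pmulrn -(dvdn_pcharf (pchar_Fp p_pr)).
by rewrite NegzE mulrNz oppr_eq0 -pmulrn -(dvdn_pcharf (pchar_Fp p_pr)) abszN.
Qed.

(** Euler's criterion as a boolean: for odd p the exponent [p./2] is (p - 1) / 2. Multiples of p get
    [false], like nonsquares. *)
Definition quad_char (a : int) : bool := (a%:~R : 'F_p) ^+ p./2 == 1.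

Lemma Fp_1_neq_N1 : (1 == -1 :> 'F_p) = false.
Proof.
rewrite -subr_eq0 opprK -[1 + 1]/(2%:R) -(dvdn_pcharf (pchar_Fp p_pr)).
by rewrite dvdn_prime2 //; apply/eqP => e; move: p_odd; rewrite e.
Qed.

Lemma quad_charM a b : ~~ (p%:Z %| a)%Z -> ~~ (p%:Z %| b)%Z ->
  quad_char (a * b) = (quad_char a == quad_char b).
Proof.
rewrite -!Fp_intr_eq0 /quad_char intrM exprMn => /Fp_expf_half[->|->] /Fp_expf_half[->|->];
  by rewrite ?mulr1 ?mul1r ?mulrNN ?mulr1 ?eqxx // [-1 == 1]eq_sym Fp_1_neq_N1.
Qed.

Lemma quad_charP a : ~~ (p%:Z %| a)%Z ->
  reflect (exists s : int, (p%:Z %| s ^+ 2 - a)%Z) (quad_char a).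
Proof.
rewrite -Fp_intr_eq0 => a0; apply: (iffP eqP) => [/(Fp_square_half a0)[y ey]|[s]].
  exists (y : nat)%:Z; rewrite -Fp_intr_eq0 rmorphB rmorphXn /= -pmulrn natr_Zp.
  by rewrite ey subrr.
rewrite -Fp_intr_eq0 rmorphB rmorphXn subr_eq0 /= => /eqP es; move: a0; rewrite -es.
rewrite sqrf_eq0 => s0; rewrite -exprM mulnC.
by have := Fp_expf_pred s0; rewrite pE.
Qed.

Lemma quad_charN1 : quad_char (-1).
Proof. by rewrite /quad_char rmorphN1 -signr_odd (negbTE p2_odd). Qed.

Section GaussSum.
Variables (L : finFieldType) (l : nat) (pl : prime l) (l_odd : odd l).
Variables (lL : l \in [pchar L]) (z : L) (pz : p.-primitive_root z).

(** The quadratic character with values in L. With [e], the additive character attached to z, it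
    forms the quadratic Gauss sum [gauss]. *)
Let c (a : 'F_p) : L := if a == 0 then 0 else if a ^+ p./2 == 1 then 1 else -1.
Let e (a : 'F_p) : L := z ^+ a.

Let cM a b : c (a * b) = c a * c b.
Proof.
rewrite /c mulf_eq0; have [->|a0] /= := eqVneq a 0; first by rewrite mul0r.
have [_|b0] := eqVneq b 0; first by rewrite mulr0.
rewrite exprMn; have [->|->] := Fp_expf_half a0; have [->|->] := Fp_expf_half b0;
  by rewrite ?mulr1 ?mul1r ?mulrNN ?mulr1 ?eqxx // ![-1 == 1]eq_sym Fp_1_neq_N1 ?mulrNN ?mulr1.
Qed.

Let eD a b : e (a + b) = e a * e b.
Proof.
rewrite /e -exprD -(prim_expr_mod pz (a + b)%N); congr (z ^+ _).
by rewrite -{5}(Fp_cast p_pr).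
Qed.

Let e0 : e 0 = 1. Proof. by []. Qed.

Let e_neq1 a : a != 0 -> e a != 1.
Proof.
move=> a0; rewrite /e -(prim_order_dvd pz); apply: contra a0 => pa.
have lt : (a < p)%N by have := ltn_ord a; rewrite {2}Fp_cast.
by apply/eqP/val_inj => /=; case: (nat_of_ord a) pa lt => // n /dvdn_leq; lia.
Qed.

Let sum_e (t : 'F_p) : \sum_a e (a * t) = if t == 0 then p%:R else 0.
Proof.
have [->|t0] := eqVneq.
  under eq_bigr => a _ do rewrite mulr0 e0.
  by rewrite sumr_const card_Fp.
have := e_neq1 t0; rewrite -subr_eq0 => /mulfI; apply.
rewrite mulr0 mulrBl mul1r mulr_sumr [X in _ - X](reindex_inj (addrI 1)) /=.
by apply/eqP; rewrite subr_eq0; apply/eqP; apply: eq_bigr => a _; rewrite mulrDl mul1r eD.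
Qed.

Let two_neq0 : 2%:R != 0 :> L.
Proof.
rewrite -(dvdn_pcharf lL) dvdn_prime2 //; apply/eqP => l2.
by move: l_odd; rewrite l2.
Qed.

Let c1_sqr a : a != 0 -> c a ^+ 2 = 1.
Proof. by rewrite /c => /negbTE ->; case: ifP; rewrite ?sqrrN expr1n. Qed.

(** Substituting g a for a, with g a primitive root and hence a nonsquare, changes the sign of the
    sum; the characteristic is odd, so the sum vanishes. *)
Let sum_c : \sum_a c a = 0.
Proof.
have [g pg] := Fp_prim_root.
have g0 : g != 0.
  apply/eqP => g0; have := prim_expr_order pg; rewrite g0 expr0n.
  have := prime_gt1 p_pr; by case: (p) => [|[|n]] //= _ /eqP.
have cg : c g = -1.
  rewrite /c (negbTE g0) -(prim_order_dvd pg) pE; case: ifP => // /dvdn_leq.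
  have h : (0 < p./2)%N by rewrite half_gt0 prime_gt1.
  by move/(_ h); rewrite leqNgt ltn_Pmulr.
apply: (mulfI two_neq0); rewrite mulr0 mulr2n mulrDl mul1r.
rewrite {1}(reindex_inj (mulfI g0)) /= -[X in _ + X]mul1r.
under eq_bigr => a _ do rewrite cM cg.
by rewrite -mulr_sumr -mulrDl addNr mul0r.
Qed.

Let gauss := \sum_a c a * e a.

(** After b = a t the coefficient c(a) c(a t) is c(t), and the sum of e(a (1 + t)) over nonzero a is
    p - 1 for t = -1 and -1 otherwise. As the sum of [c] vanishes, p c(-1) remains, and c(-1) = 1
    because p = 1 mod 4. *)
Let gauss_sqr : gauss ^+ 2 = p%:R.
Proof.
have c0 : c 0 = 0 by rewrite /c eqxx.
have -> : gauss ^+ 2 = \sum_(a | a != 0) \sum_b c a * e a * (c b * e b).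
  rewrite expr2 {1}/gauss mulr_suml (bigD1 0) //= c0 !mul0r add0r.
  by apply: eq_bigr => a _; rewrite /gauss mulr_sumr.
have -> : \sum_(a | a != 0) \sum_b c a * e a * (c b * e b) =
          \sum_(a | a != 0) \sum_t c t * e (a * (1 + t)).
  apply: eq_bigr => a a0; rewrite (reindex_inj (mulfI a0)) /=; apply: eq_bigr => t _.
  have ca := c1_sqr a0; rewrite mulrDr mulr1 eD cM.
  by rewrite -[RHS]mul1r -ca; ring.
rewrite exchange_big /=.
have -> : \sum_t \sum_(a | a != 0) c t * e (a * (1 + t)) =
          \sum_t (c t * (if 1 + t == 0 then p%:R else 0) - c t).
  apply: eq_bigr => t _; rewrite -mulr_sumr -sum_e [in RHS](bigD1 0) //= mul0r e0.
  by rewrite mulrDr mulr1 addrAC subrr add0r.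
rewrite sumrB sum_c subr0 (bigD1 (-1)) //= subrr eqxx big1 ?addr0 => [|t tN1].
  rewrite /c oppr_eq0 oner_eq0 -signr_odd (negbTE p2_odd) expr0 eqxx mul1r //.
by rewrite addrC addr_eq0 (negbTE tN1) mulr0.
Qed.

(** The l-th power map is additive, fixes the values of [c] since l is odd, and sends e(a) to e(l
    a). Reindexing brings out c(l), which is its own inverse and is written as a power of -1. *)
Let gauss_Frobenius : ~~ (p %| l)%N -> gauss ^+ l = (-1) ^+ (~~ quad_char l%:Z) * gauss.
Proof.
move=> pl'; pose lp : 'F_p := l%:R.
have lp0 : lp != 0 by rewrite /lp -(dvdn_pcharf (pchar_Fp p_pr)).
have cl : c lp = (-1) ^+ (~~ quad_char l%:Z).
  by rewrite /c (negbTE lp0) /quad_char -pmulrn -/lp; case: eqP.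
have cX a : c a ^+ l = c a.
  rewrite /c; case: ifP => _; first by rewrite expr0n; case: (l) (prime_gt0 pl).
  by case: ifP => _; rewrite ?expr1n // -signr_odd l_odd.
have eX a : e a ^+ l = e (lp * a).
  rewrite /e -exprM -(prim_expr_mod pz); congr (z ^+ _).
  rewrite -[lp]natr_Zp -{2}[a]natr_Zp -natrM val_Fp_nat // /lp val_Fp_nat //.
  by rewrite modnMml mulnC.
rewrite -(pFrobenius_autE lL) rmorph_sum /=.
rewrite -cl; have -> : gauss = c lp * \sum_a c a * e (lp * a).
  rewrite /gauss (reindex_inj (mulfI lp0)) mulr_sumr; apply: eq_bigr => a _.
  by rewrite cM mulrA.
rewrite mulrA -expr2 c1_sqr // mul1r; apply: eq_bigr => a _.
by rewrite rmorphM /= !pFrobenius_autE cX eX.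
Qed.

Lemma gauss_sum_exists : ~~ (p %| l)%N ->
  exists g : L, g ^+ 2 = p%:R /\ g ^+ l = (-1) ^+ (~~ quad_char l%:Z) * g.
Proof. by move=> h; exists gauss; rewrite gauss_sqr gauss_Frobenius. Qed.
End GaussSum.
End QuadraticCharacter.

(** * Quadratic reciprocity, the character of 2, and sums of two squares *)

Section Reciprocity.
Variables (l : nat) (l_pr : prime l) (l_odd : odd l).

(** Such a g is t or -t, so it lies in the prime field and is fixed by the l-th power map; as l is
    odd, the sign must be trivial. *)
Lemma Frobenius_sqrt_intr (L : finFieldType) (g : L) (t : int) (b : bool) :
  l \in [pchar L] -> g ^+ 2 = t%:~R ^+ 2 -> g != 0 -> g ^+ l = (-1) ^+ b * g -> ~~ b.
Proof.
move=> lL /eqP; rewrite eqf_sqr => gt g0.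
have -> : g ^+ l = g.
  case/orP: gt => /eqP ->; rewrite -(pFrobenius_autE lL) ?rmorphN /=;
  by rewrite pFrobenius_aut_int.
case: b => //; rewrite expr1 mulN1r => /eqP; rewrite -addr_eq0 -mulr2n -mulr_natl.
rewrite mulf_eq0 (negbTE g0) orbF -(dvdn_pcharf lL) dvdn_prime2 // => /eqP l2.
by move: l_odd; rewrite l2.
Qed.

(** The Gauss sum of p has square p = t^2 in characteristic l, so Frobenius fixes it; but Frobenius
    multiplies it by the character of l modulo p. *)
Lemma quad_char_reciprocity (p : nat) (t : int) : prime p -> (p = 1 %[mod 4])%N ->
  l != p -> (l%:Z %| t ^+ 2 - p%:Z)%Z -> quad_char p l%:Z.
Proof.
move=> p_pr p4 lp lt.
have cop : coprime l p by rewrite prime_coprime // dvdn_prime2.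
have [L [z [lL pz]]] := prim_root_exists_pchar l_pr (prime_gt0 p_pr) cop.
have pl : ~~ (p %| l)%N by rewrite dvdn_prime2 // eq_sym.
have [g [g2 gl]] := gauss_sum_exists p_pr p4 l_pr l_odd lL pz pl.
rewrite -[quad_char _ _]negbK; apply: (Frobenius_sqrt_intr lL _ _ gl (t := t)).
  apply/eqP; rewrite g2 eq_sym -subr_eq0 -rmorphXn [p%:R]pmulrn -intrB /=.
  by case/dvdzP: lt => q ->; rewrite intrM -pmulrn (pcharf0 lL) mulr0.
by rewrite -sqrf_eq0 g2 -(dvdn_pcharf lL) dvdn_prime2.
Qed.

(** The same argument for the product of the two Gauss sums, formed in one field with a pq-th root
    of unity: Frobenius fixes the product, so the two signs cancel, although each may be -1. *)
Lemma quad_char_reciprocity2 (p q : nat) (t : int) :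
  prime p -> (p = 1 %[mod 4])%N -> prime q -> (q = 1 %[mod 4])%N -> p != q ->
  l != p -> l != q -> (l%:Z %| t ^+ 2 - (p * q)%:Z)%Z ->
  quad_char p l%:Z = quad_char q l%:Z.
Proof.
move=> p_pr p4 q_pr q4 pq lp lq lt.
have cop : coprime l (p * q) by rewrite coprimeMr !prime_coprime // !dvdn_prime2 ?lp.
have pq0 : (0 < p * q)%N by rewrite muln_gt0 !prime_gt0.
have [L [z [lL pz]]] := prim_root_exists_pchar l_pr pq0 cop.
have zp : p.-primitive_root (z ^+ q).
  by have := dvdn_prim_root pz (dvdn_mulr q (dvdnn p)); rewrite mulKn ?prime_gt0.
have zq : q.-primitive_root (z ^+ p).
  by have := dvdn_prim_root pz (dvdn_mull p (dvdnn q)); rewrite mulnK ?prime_gt0.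
have pl : ~~ (p %| l)%N by rewrite dvdn_prime2 // eq_sym.
have ql : ~~ (q %| l)%N by rewrite dvdn_prime2 // eq_sym.
have [g [g2 gl]] := gauss_sum_exists p_pr p4 l_pr l_odd lL zp pl.
have [h [h2 hl]] := gauss_sum_exists q_pr q4 l_pr l_odd lL zq ql.
suff : ~~ (~~ quad_char p l%:Z (+) ~~ quad_char q l%:Z).
  by case: (quad_char p _); case: (quad_char q _).
apply: (@Frobenius_sqrt_intr L (g * h) t) => //.
- apply/eqP; rewrite exprMn g2 h2 -natrM eq_sym -subr_eq0 -rmorphXn [(p * q)%:R]pmulrn -intrB /=.
  by case/dvdzP: lt => c ->; rewrite intrM -pmulrn (pcharf0 lL) mulr0.
- by rewrite mulf_neq0 // -sqrf_eq0 ?g2 ?h2 -(dvdn_pcharf lL) dvdn_prime2.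
by rewrite exprMn gl hl signr_addb; ring.
Qed.
End Reciprocity.

(** If i^2 = -1, then (1 + i)^2 = 2i, so 2 and i have the same character, and i^((p-1)/2) =
    (-1)^((p-1)/4). *)
Lemma quad_char2 (p : nat) : prime p -> (p = 1 %[mod 4])%N ->
  quad_char p 2 = (p == 1 %[mod 8])%N.
Proof.
move=> p_pr p4; have [g pg] := Fp_prim_root p_pr.
have p3 : (2 < p)%N by have := prime_gt1 p_pr; case: (p) p4 => [|[|[|]]].
have pm4 : (4 %| p.-1)%N by move: p4 p3; lia.
pose r := (p.-1 %/ 4)%N.
have p1r : p.-1 = (r * 4)%N by rewrite divnK.
have p2r : p./2 = (2 * r)%N by move: p1r p3; clear; lia.
pose i := g ^+ r.
have i2 : i ^+ 2 = -1.
  have : (i ^+ 2) ^+ 2 == 1 by rewrite -!exprM -p1r prim_expr_order.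
  rewrite sqrf_eq1 => /orP[]/eqP // /eqP.
  rewrite -exprM -(prim_order_dvd pg) => /dvdn_leq.
  by move: p1r p3; clear; lia.
have i0 : i != 0 by rewrite -sqrf_eq0 i2 oppr_eq0 oner_eq0.
have two0 : 2%:R != 0 :> 'F_p.
  by rewrite -(dvdn_pcharf (pchar_Fp p_pr)) gtnNdvd.
have e2i : (1 + i) ^+ 2 = 2%:R * i by rewrite sqrrD i2 expr1n mul1r addrAC subrr add0r mulr_natl.
have n0 : 1 + i != 0 by rewrite -sqrf_eq0 e2i mulf_neq0.
have h1 : (2%:R * i) ^+ p./2 = 1.
  rewrite -e2i -exprM; have -> : (2 * p./2 = p.-1)%N by move: p1r p2r; clear; lia.
  exact: Fp_expf_pred.
have -> : quad_char p 2 = (i ^+ p./2 == 1).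
  rewrite /quad_char -[2%:~R]/(2%:R); move: h1; rewrite exprMn.
  have [->|->] := Fp_expf_half p_pr p4 i0; rewrite ?mulr1 ?mulrN1; first by move=> ->.
  by move=> e; rewrite -[_ ^+ _]opprK e.
rewrite p2r exprM i2 -signr_odd.
have -> : (p == 1 %[mod 8])%N = ~~ odd r by move: p1r p3; clear; lia.
case: (odd r); last by rewrite eqxx.
by rewrite eq_sym Fp_1_neq_N1.
Qed.

(** Thue's argument: with i^2 = -1 mod p, two points of the box of side floor(sqrt p) agree in u1 -
    i u2 mod p. Their difference (x, y) has x^2 + y^2 divisible by p and strictly between 0 and
    2p. *)
Lemma sum_two_squares (p : nat) : prime p -> (p = 1 %[mod 4])%N ->
  exists s t : int, p%:Z = s ^+ 2 + t ^+ 2.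
Proof.
move=> p_pr p4; have p0 := prime_gt0 p_pr.
have p3 : (2 < p)%N by have := prime_gt1 p_pr; case: (p) p4 => [|[|[|]]].
have [|i pi] := quad_charP p_pr p4 _ (quad_charN1 p_pr p4).
  by rewrite dvdzE /= dvdn1; have := prime_gt1 p_pr; case: (p) => [|[]].
have [r [r1 r2]] := floor_sqrt p.
pose f (u : 'I_r.+1 * 'I_r.+1) := residue_ord p.-1 (u.1%:Z - i * u.2%:Z).
have [|[u1 u2] [[v1 v2] [neuv /residue_ord_inj]]] := @pigeonhole _ _ f.
  by rewrite card_prod !card_ord prednK // -mulnn.
rewrite prednK //= => pf.
have {pf pi} pf : (p%:Z %| (u1%:Z - v1%:Z) ^+ 2 + (u2%:Z - v2%:Z) ^+ 2)%Z.
  rewrite [X in (_ %| X)%Z](_ : _ = (u1%:Z - i * u2%:Z - (v1%:Z - i * v2%:Z)) *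
    (u1%:Z - v1%:Z + i * (u2%:Z - v2%:Z)) + (i ^+ 2 - -1) * (u2%:Z - v2%:Z) ^+ 2); last by ring.
  by rewrite rpredD ?dvdz_mulr.
have xy0 : ~ (u1%:Z - v1%:Z = 0 /\ u2%:Z - v2%:Z = 0).
  case=> h1 h2; move/eqP: neuv; apply.
  by congr (_, _); apply: val_inj => /=; [clear -h1|clear -h2]; lia.
have r2p : r%:Z ^+ 2 < p%:Z.
  have rp : (r ^ 2 != p)%N.
    apply/eqP => e; have := p_pr.
    by rewrite -e -mulnn => /primeP[_] /(_ r); rewrite dvdn_mulr // => /(_ isT); clear -e p3; nia.
  by clear -r1 rp; lia.
have hx := le_lt_trans (sqrz_dist_ord u1 v1) r2p.
have hy := le_lt_trans (sqrz_dist_ord u2 v2) r2p.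
exists (u1%:Z - v1%:Z), (u2%:Z - v2%:Z).
move: (u1%:Z - v1%:Z) (u2%:Z - v2%:Z) pf xy0 hx hy => x y /dvdzP[q e] xy0 hx hy.
have xy_gt0 : 0 < x ^+ 2 + y ^+ 2.
  rewrite lt_neqAle eq_sym addr_ge0 ?sqr_ge0 // andbT paddr_eq0 ?sqr_ge0 //.
  by rewrite !sqrf_eq0; apply/negP => /andP[/eqP ? /eqP ?]; apply: xy0.
have p_gt0 : 0 < p%:Z :> int by [].
have xy_lt : x ^+ 2 + y ^+ 2 < 2 * p%:Z by lra.
have q1 : 0 < q by rewrite -(pmulr_lgt0 _ p_gt0) -e.
have q2 : q < 2 by rewrite -(ltr_pM2r p_gt0) -e.
have qE : q = 1 by clear -q1 q2; lia.
by rewrite e qE mul1r.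
Qed.

(** * Relative norms from k(sqrt q) *)

Lemma Euclid_dvdzM (l : nat) (a b : int) : prime l ->
  (l%:Z %| a * b)%Z = (l%:Z %| a)%Z || (l%:Z %| b)%Z.
Proof. by move=> pl; rewrite !dvdzE abszM Euclid_dvdM. Qed.

Lemma Euclid_dvdzX2 (l : nat) (a : int) : prime l -> (l%:Z %| a ^+ 2)%Z = (l%:Z %| a)%Z.
Proof. by move=> pl; rewrite expr2 Euclid_dvdzM // orbb. Qed.

Lemma sqrt_mod_chinese (a b : nat) (c s t : int) : coprime a b ->
  (a%:Z %| s ^+ 2 - c)%Z -> (b%:Z %| t ^+ 2 - c)%Z ->
  exists u : int, ((a * b)%:Z %| u ^+ 2 - c)%Z.
Proof.
move=> cop sa tb; have copz : coprimez a%:Z b%:Z by rewrite /coprimez -[_ == _]/(gcdn a b == 1%N).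
exists (zchinese a%:Z b%:Z s t).
rewrite PoszM Gauss_dvdz //.
have es := zchinese_modl copz s t; have et := zchinese_modr copz s t.
move/eqP: es et; rewrite eqz_mod_dvd => es /eqP; rewrite eqz_mod_dvd => et.
move: (zchinese _ _ _ _) es et => u es et.
have E w : u ^+ 2 - c = (u - w) * (u + w) + (w ^+ 2 - c) by ring.
by apply/andP; split; [rewrite (E s)|rewrite (E t)]; rewrite rpredD ?dvdz_mulr.
Qed.

(** * Closure properties of generated fields and of their integers *)

Section FieldGenerated.
Variable s : seq algC.
Local Notation K := (Qadjoin s).

Lemma Qadjoin_gen x : x \in s -> K x.
Proof. by move=> xs F _; apply. Qed.

Lemma Qadjoin1 : K 1.
Proof. by move=> F [F1 _ _] _. Qed.

Lemma QadjoinB x y : K x -> K y -> K (x - y).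
Proof. by move=> Kx Ky F FF sF; case: (FF) => _ FB _; apply: FB; [apply: Kx|apply: Ky]. Qed.

Lemma Qadjoin_div x y : K x -> K y -> K (x / y).
Proof. by move=> Kx Ky F FF sF; case: (FF) => _ _ FD; apply: FD; [apply: Kx|apply: Ky]. Qed.

Lemma Qadjoin0 : K 0.
Proof. by rewrite -(subrr 1); apply: QadjoinB; apply: Qadjoin1. Qed.

Lemma QadjoinN x : K x -> K (- x).
Proof. by move=> Kx; rewrite -sub0r; apply: QadjoinB => //; apply: Qadjoin0. Qed.

Lemma QadjoinD x y : K x -> K y -> K (x + y).
Proof. by move=> Kx Ky; rewrite -(opprK y); apply: QadjoinB => //; apply: QadjoinN. Qed.

Lemma QadjoinV x : K x -> K x^-1.
Proof. by move=> Kx; rewrite -div1r; apply: Qadjoin_div => //; apply: Qadjoin1. Qed.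

Lemma QadjoinM x y : K x -> K y -> K (x * y).
Proof. by move=> Kx Ky; rewrite -(invrK y); apply: Qadjoin_div => //; apply: QadjoinV. Qed.

Lemma QadjoinX x n : K x -> K (x ^+ n).
Proof.
by move=> Kx; elim: n => [|n IH]; rewrite ?expr0 ?exprS; [apply: Qadjoin1|apply: QadjoinM].
Qed.

Lemma Qadjoin_nat n : K n%:R.
Proof.
by elim: n => [|n IH]; rewrite ?mulrS; [apply: Qadjoin0|apply: QadjoinD=> //; apply: Qadjoin1].
Qed.

Lemma Qadjoin_int n : K n%:~R.
Proof.
by case: n => n; rewrite ?NegzE ?mulrNz; [|apply: QadjoinN]; apply: Qadjoin_nat.
Qed.

Local Notation O := (integers_of K).

Lemma intring0 : O 0.
Proof. by split; [apply: Qadjoin0|apply: Aint0]. Qed.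

Lemma intring1 : O 1.
Proof. by split; [apply: Qadjoin1|apply: Aint1]. Qed.

Lemma intringD x y : O x -> O y -> O (x + y).
Proof. by move=> [kx Ax] [ky Ay]; split; [apply: QadjoinD|rewrite rpredD]. Qed.

Lemma intringM x y : O x -> O y -> O (x * y).
Proof. by move=> [kx Ax] [ky Ay]; split; [apply: QadjoinM|rewrite rpredM]. Qed.

Lemma intringN x : O x -> O (- x).
Proof. by move=> [kx Ax]; split; [apply: QadjoinN|rewrite rpredN]. Qed.

Lemma intringB x y : O x -> O y -> O (x - y).
Proof. by move=> Ox Oy; apply: intringD => //; apply: intringN. Qed.

Lemma intring_int n : O n%:~R.
Proof. by split; [apply: Qadjoin_int|apply: Aint_int]. Qed.
End FieldGenerated.

Arguments intring0 {s}.
Arguments intring1 {s}.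
Arguments intring_int {s} n.

Lemma Qadjoin_sub s s' : (forall x, x \in s -> Qadjoin s' x) -> Qadjoin s `<=` Qadjoin s'.
Proof. by move=> ss x Kx F FF sF; apply: Kx => // y ys; apply: (ss y ys F FF sF). Qed.

(** The numbers a + b sqrt N form a field for every N, so this field is one of those intersected.
    When N is a square a nonzero divisor may have norm zero, which calls for a separate case. *)
Lemma Qadjoin_sqrtP (N : nat) x : Qadjoin [:: sqrtC N%:R] x ->
  exists a b : rat, x = ratr a + ratr b * sqrtC N%:R.
Proof.
pose r : algC := sqrtC N%:R.
have r2 : r ^+ 2 = N%:R by rewrite sqrtCK.
move=> Kx; pose F := [pred x : algC | `[< exists a b : rat, x = ratr a + ratr b * r >]].
have FE u : (u \in F) = `[< exists a b : rat, u = ratr a + ratr b * r >] by [].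
suff : x \in F by rewrite FE => /asboolP.
apply: Kx; last first.
  move=> y; rewrite mem_seq1 => /eqP ->; rewrite FE; apply/asboolP; exists 0, 1.
  by rewrite rmorph0 rmorph1 add0r mul1r.
split.
- by rewrite FE; apply/asboolP; exists 1, 0; rewrite rmorph0 rmorph1 mul0r addr0.
- move=> u v; rewrite !FE => /asboolP[a [b ->]] /asboolP[c [d ->]]; apply/asboolP.
  by exists (a - c), (b - d); rewrite !rmorphB /=; ring.
move=> u v; rewrite !FE => /asboolP[a [b ->]] /asboolP[c [d ->]]; apply/asboolP.
pose n := c ^+ 2 - N%:R * d ^+ 2.
have en : ratr n = (ratr c + ratr d * r) * (ratr c - ratr d * r).
  by rewrite /n !expr2 rmorphB !rmorphM /= ratr_nat -r2; ring.
clearbody n; have [n0|n0] := eqVneq n 0; last first.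
  exists ((a * c - N%:R * b * d) / n), ((b * c - a * d) / n).
  have : ratr n != 0 :> algC by rewrite fmorph_eq0.
  rewrite !fmorph_div !rmorphB /= !rmorphM /= ratr_nat -r2 en mulf_eq0 negb_or => /andP[h1 h2].
  by field; rewrite h1 h2.
have [->|y0] := eqVneq (ratr c + ratr d * r) 0.
  by exists 0, 0; rewrite invr0 mulr0 rmorph0 mul0r addr0.
(* The divisor is nonzero and its norm is zero, so its conjugate is zero and the divisor is the
   rational number 2c. *)
have d0 : ratr d * r = ratr c.
  move/eqP: en; rewrite n0 rmorph0 eq_sym mulf_eq0 (negbTE y0) /= subr_eq0 => /eqP ->.
  by [].
have c0 : ratr c != 0 :> algC.
  by apply: contra_neq y0 => e; rewrite d0 e addr0.
exists (a / (c *+ 2)), (b / (c *+ 2)); rewrite d0 !fmorph_div /= rmorphMn /=.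
by rewrite mulr2n mulrDl; congr (_ + _); rewrite mulrAC.
Qed.

Section RelativeNorms.
Variables (p q : nat).
Local Notation k := (Qadjoin [:: sqrtC p%:R]).

(** The norm form of k(sqrt q) over k, with coordinates in k; in this form the larger field need not
    be constructed. *)
Definition is_rel_norm (c : algC) : Prop :=
  exists X Y, [/\ k X, k Y & c = X ^+ 2 - q%:R * Y ^+ 2].

Lemma rel_normM c d : is_rel_norm c -> is_rel_norm d -> is_rel_norm (c * d).
Proof.
move=> [A [B [kA kB ->]]] [C [D [kC kD ->]]].
exists (A * C + q%:R * B * D), (A * D + B * C); split; last by ring.
- apply: QadjoinD; first exact: QadjoinM.
  by apply: QadjoinM => //; apply: QadjoinM => //; apply: Qadjoin_nat.
- by apply: QadjoinD; apply: QadjoinM.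
Qed.

Lemma rel_norm_sqr c : k c -> is_rel_norm (c ^+ 2).
Proof. by move=> kc; exists c, 0; split=> //; [apply: Qadjoin0|ring]. Qed.

Lemma rel_norm_divr_sqr (c d : algC) : k d -> is_rel_norm c -> is_rel_norm (c / d ^+ 2).
Proof.
move=> kd nc; rewrite -exprVn; apply: rel_normM => //; apply: rel_norm_sqr.
exact: QadjoinV.
Qed.

Lemma rel_norm_of_rat_solution (n : nat) (x y z : int) : z != 0 ->
  x ^+ 2 = q%:Z * y ^+ 2 + n%:Z * z ^+ 2 -> is_rel_norm n%:R.
Proof.
move=> z0 e; exists (x%:~R / z%:~R), (y%:~R / z%:~R); split.
- by apply: Qadjoin_div; apply: Qadjoin_int.
- by apply: Qadjoin_div; apply: Qadjoin_int.
have z0' : z%:~R != 0 :> algC by rewrite intr_eq0.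
have := congr1 (fun i : int => i%:~R : algC) e.
rewrite !expr2 intrD !intrM -!pmulrn => e'.
by rewrite !mulf_div e'; field.
Qed.

(** The factor p is absorbed into the second coordinate: p q y^2 = q (sqrt p y)^2 with sqrt p in
    k. *)
Lemma rel_norm_of_twisted_solution (n : nat) (x y z : int) : z != 0 ->
  x ^+ 2 = (p * q)%:Z * y ^+ 2 + n%:Z * z ^+ 2 -> is_rel_norm n%:R.
Proof.
move=> z0 e; exists (x%:~R / z%:~R), (sqrtC p%:R * (y%:~R / z%:~R)); split.
- by apply: Qadjoin_div; apply: Qadjoin_int.
- apply: QadjoinM; first by apply: Qadjoin_gen; rewrite inE.
  by apply: Qadjoin_div; apply: Qadjoin_int.
have z0' : z%:~R != 0 :> algC by rewrite intr_eq0.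
have := congr1 (fun i : int => i%:~R : algC) e.
rewrite !expr2 intrD !intrM -!pmulrn natrM => e'.
by rewrite [X in q%:R * X]mulrACA -(expr2 (sqrtC _)) sqrtCK !mulf_div e'; field.
Qed.

(** From q = s^2 + t^2 one gets -1 = (s/t)^2 - q (1/t)^2; t is nonzero because the prime q is not a
    square. *)
Lemma rel_normN1 : prime q -> (q = 1 %[mod 4])%N -> is_rel_norm (-1).
Proof.
move=> q_pr q4; have [s [t e]] := sum_two_squares q_pr q4.
have t0 : t != 0.
  apply/eqP => t0; move: q_pr; have -> : q = (`|s| * `|s|)%N by move: e; rewrite t0; clear; lia.
  by case/primeP => s1 /(_ `|s|%N); rewrite dvdn_mulr // => /(_ isT); move: s1; clear; nia.
have t0' : t%:~R != 0 :> algC by rewrite intr_eq0.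
exists (s%:~R / t%:~R), (1 / t%:~R); split.
- by apply: Qadjoin_div; apply: Qadjoin_int.
- by apply: Qadjoin_div; [apply: Qadjoin1|apply: Qadjoin_int].
have := congr1 (fun i : int => i%:~R : algC) e.
rewrite intrD !rmorphXn /= -!pmulrn => ->.
by field.
Qed.
End RelativeNorms.

Lemma quad_char_mulsqr (p a l : nat) : prime p -> (p = 1 %[mod 4])%N ->
  ~~ (p%:Z %| a%:Z)%Z -> ~~ (p %| l)%N -> quad_char p (a * l ^ 2)%:Z = quad_char p a%:Z.
Proof.
move=> p_pr p4 pa pl; have pl2 : ~~ (p%:Z %| (l * l)%:Z)%Z.
  by rewrite dvdzE Euclid_dvdM // negb_or pl.
rewrite -mulnn PoszM (quad_charM p_pr p4 pa pl2) PoszM quad_charM ?dvdzE // eqxx.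
by case: (quad_char p a).
Qed.

(** * A criterion for a rational integer to be a norm from k(sqrt q) *)

Section NormCriterion.
Variables (p q : nat).
Hypotheses (p_pr : prime p) (q_pr : prime q) (neq_pq : p != q).
Hypotheses (p4 : (p = 1 %[mod 4])%N) (q4 : (q = 1 %[mod 4])%N).
Local Notation k := (Qadjoin [:: sqrtC p%:R]).

(** The primes splitting in Q(sqrt q). Every integer is a square modulo 2, so l = 2 needs its own
    clause; [twisted_prime] is the analogue for Q(sqrt (p q)). *)
Definition split_prime (l : nat) : Prop :=
  [/\ l != q, l = 2%N -> (q = 1 %[mod 8])%N & exists t : int, (l%:Z %| t ^+ 2 - q%:Z)%Z].

Definition twisted_prime (l : nat) : Prop :=
  [/\ l != p, l != q, l = 2%N -> (p * q = 1 %[mod 8])%N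
    & exists t : int, (l%:Z %| t ^+ 2 - (p * q)%:Z)%Z].

Lemma split_prime_char l : prime l -> split_prime l -> quad_char q l%:Z.
Proof.
move=> l_pr [lq l2 [t lt]]; case: (even_prime l_pr) => [e|l_odd].
  by rewrite e quad_char2 //; apply/eqP; apply: l2.
by apply: (quad_char_reciprocity l_pr l_odd (t := t)).
Qed.

Lemma twisted_prime_char l : prime l -> twisted_prime l ->
  quad_char p l%:Z = quad_char q l%:Z.
Proof.
move=> l_pr [lp lq l2 [t lt]]; case: (even_prime l_pr) => [e|l_odd].
  by rewrite e !quad_char2 //; move: (l2 e) p4 q4; clear; nia.
by apply: (quad_char_reciprocity2 l_pr l_odd (t := t)).
Qed.

Lemma prime_not_square l : prime l -> ~ exists r : nat, l = (r ^ 2)%N.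
Proof.
move=> l_pr [r e]; move: l_pr; rewrite e -mulnn.
by case/primeP => s1 /(_ r); rewrite dvdn_mulr // => /(_ isT); move: s1; clear; nia.
Qed.

Lemma prime_dvdzN (l m : nat) : prime l -> prime m -> l != m -> ~~ (l%:Z %| m%:Z)%Z.
Proof. by move=> l_pr m_pr lm; rewrite dvdzE dvdn_prime2. Qed.

Lemma split_prime_norm l : prime l -> split_prime l -> is_rel_norm p q l%:R.
Proof.
move=> l_pr sl; have := split_prime_char l_pr sl; case: sl => lq _ [t lt].
have ql : ~~ (q%:Z %| l%:Z)%Z by rewrite prime_dvdzN // eq_sym.
case/(quad_charP q_pr q4 ql) => s qs.
have cop : coprime q l by rewrite prime_coprime // dvdn_prime2 // eq_sym.
have [x [y [z [z0 e]]]] := legendre_solvable (prime_gt0 q_pr) (prime_gt0 l_pr) cop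
  (prime_not_square q_pr) qs lt.
exact: (rel_norm_of_rat_solution p z0 e).
Qed.

Lemma twisted_norm (B : nat) (t : int) : (0 < B)%N -> ~~ (p%:Z %| B%:Z)%Z -> ~~ (q%:Z %| B%:Z)%Z ->
  quad_char p B%:Z -> quad_char q B%:Z -> (B%:Z %| t ^+ 2 - (p * q)%:Z)%Z ->
  is_rel_norm p q B%:R.
Proof.
move=> B0 pB qB.
case/(quad_charP p_pr p4 pB) => s1 e1; case/(quad_charP q_pr q4 qB) => s2 e2 tB.
have cop : coprime p q by rewrite prime_coprime // dvdn_prime2.
have [s es] := sqrt_mod_chinese cop e1 e2.
have pq0 : (0 < p * q)%N by rewrite muln_gt0 !prime_gt0.
have copB : coprime (p * q) B by rewrite coprimeMl !prime_coprime // pB.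
have nsq : ~ exists r : nat, (p * q)%N = (r ^ 2)%N.
  case=> r e; have : (p %| r ^ 2)%N by rewrite -e dvdn_mulr.
  rewrite Euclid_dvdX // => /andP[/dvdnP[c ec] _].
  have : (p %| q)%N.
    rewrite -(dvdn_pmul2l (prime_gt0 p_pr)) e ec expnMn [X in _ (p * p)%N X]mulnC -mulnn.
    by rewrite dvdn_mulr.
  by rewrite dvdn_prime2 // (negbTE neq_pq).
have [x [y [z [z0 e]]]] := legendre_solvable pq0 B0 copB nsq es tB.
exact: (rel_norm_of_twisted_solution z0 e).
Qed.

(** [B] collects twisted primes of odd exponent, so that n B is a square times split primes; the
    induction removes l^2, or a prime l of exponent one. A single twisted prime may have character
    -1 for both p and q and then escapes [twisted_norm]; only the character of the whole product is
    under control, so [B] is carried along. *)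
Lemma norm_up_to_twisted (n : nat) : (0 < n)%N -> ~~ (q %| n)%N ->
  (forall l, prime l -> odd (logn l n) -> split_prime l \/ twisted_prime l) ->
  exists B : nat, [/\ (0 < B)%N, (B %| n)%N, ~~ (p %| B)%N, ~~ (q %| B)%N &
    [/\ is_rel_norm p q (n * B)%:R, quad_char q (n * B)%:Z, quad_char p B%:Z = quad_char q B%:Z
      & exists t : int, (B%:Z %| t ^+ 2 - (p * q)%:Z)%Z]].
Proof.
elim/ltn_ind: n => n IH n0 qn hn.
have [n1|n1] := leqP n 1.
  have -> : n = 1%N by clear -n0 n1; lia.
  exists 1%N; split; rewrite ?dvdn1 //; try by rewrite neq_ltn prime_gt1 ?orbT.
  split.
  - by rewrite -(expr1n _ 2); apply: rel_norm_sqr; apply: Qadjoin1.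
  - by rewrite /quad_char expr1n.
  - by rewrite /quad_char !expr1n !eqxx.
  - by exists 0; rewrite dvd1z.
have [l l_pr /dvdnP[m em]] : exists2 l, prime l & (l %| n)%N.
  by exists (pdiv n); [apply: pdiv_prime|apply: pdiv_dvd].
have l1 := prime_gt1 l_pr.
have m0 : (0 < m)%N by move: n0; rewrite em muln_gt0 => /andP[].
have ql : ~~ (q %| l)%N by apply: contra qn => h; rewrite em dvdn_mull.
have [/dvdnP[m' em']|lm] := boolP (l %| m)%N.
  have e : n = (m' * l ^ 2)%N by rewrite em em' -mulnA mulnn.
  have m'0 : (0 < m')%N by move: n0; rewrite e muln_gt0 => /andP[].
  have ltm : (m' < n)%N by rewrite e ltn_Pmulr // -(exp1n 2) ltn_exp2r.
  have qm' : ~~ (q %| m')%N by apply: contra qn => h; rewrite e dvdn_mulr.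
  have [|B [B0 Bm pB qB [h1 h2 h3 h4]]] := IH m' ltm m'0 qm'.
    move=> l' l'_pr ol; apply: hn => //.
    have l20 : (0 < l ^ 2)%N by rewrite expn_gt0 prime_gt0.
    by rewrite e (lognM l' m'0 l20) (lognX l' l 2) oddD oddM /= addbF.
  exists B; split=> //; first by rewrite e dvdn_mulr.
  have -> : (n * B)%N = (m' * B * l ^ 2)%N by rewrite e; ring.
  have qmB : ~~ (q%:Z %| (m' * B)%:Z)%Z by rewrite dvdzE Euclid_dvdM // negb_or qm'.
  split=> //.
  - rewrite natrM; apply: rel_normM => //; rewrite natrX; apply: rel_norm_sqr.
    exact: Qadjoin_nat.
  - by rewrite quad_char_mulsqr.
have ltm : (m < n)%N by rewrite em ltn_Pmulr.
have qm : ~~ (q %| m)%N by apply: contra qn => h; rewrite em dvdn_mulr.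
have logm l' : prime l' -> l' != l -> logn l' n = logn l' m.
  move=> l'_pr ll; rewrite em (lognM _ m0 (prime_gt0 l_pr)).
  by rewrite (logn_prime _ l_pr) (negbTE ll) addn0.
have logl : logn l n = 1%N.
  by rewrite em (lognM _ m0 (prime_gt0 l_pr)) (logn_prime _ l_pr) eqxx lognE l_pr m0 (negbTE lm).
have [|B [B0 Bm pB qB [h1 h2 h3 [t h4]]]] := IH m ltm m0 qm.
  move=> l' l'_pr ol; apply: hn => //; rewrite logm //.
  by apply: contraTneq ol => ->; rewrite lognE l_pr m0 (negbTE lm).
have qmB : ~~ (q%:Z %| (m * B)%:Z)%Z by rewrite dvdzE Euclid_dvdM // negb_or qm.
have [sl|tl] : split_prime l \/ twisted_prime l by apply: hn; rewrite ?logl.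
  exists B; split=> //; first by rewrite em dvdn_mulr.
  have -> : (n * B)%N = (m * B * l)%N by rewrite em; ring.
  split=> //; last by exists t.
  - by rewrite natrM; apply: rel_normM => //; apply: split_prime_norm.
  - by rewrite PoszM quad_charM // h2 split_prime_char.
case: (tl) => lp lq _ [u lu].
exists (B * l)%N; split.
- by rewrite muln_gt0 B0 prime_gt0.
- by rewrite em dvdn_mul.
- by rewrite Euclid_dvdM // negb_or pB dvdn_prime2 // eq_sym.
- by rewrite Euclid_dvdM // negb_or qB dvdn_prime2 // eq_sym.
have -> : (n * (B * l))%N = (m * B * l ^ 2)%N by rewrite em; ring.
split.
- rewrite natrM; apply: rel_normM => //; rewrite natrX; apply: rel_norm_sqr.
  exact: Qadjoin_nat.
- by rewrite quad_char_mulsqr.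
- rewrite PoszM !quad_charM // ?h3 ?twisted_prime_char //.
  by rewrite dvdzE dvdn_prime2 // eq_sym.
have [|w ew] := sqrt_mod_chinese (c := (p * q)%:Z) (a := B) (b := l) _ h4 lu.
  by rewrite coprime_sym prime_coprime //; apply: contra lm => h; apply: dvdn_trans h Bm.
by exists w.
Qed.

(** The characters of n and of n B at q being trivial, so are those of B, and n = (n B) B / B^2 is a
    norm. A negative sign of n is harmless, -1 being both a norm and a square mod q. *)
Lemma rel_norm_criterion (n : int) : n != 0 -> ~~ (q%:Z %| n)%Z -> quad_char q n ->
  (forall l, prime l -> odd (logn l `|n|) -> split_prime l \/ twisted_prime l) ->
  is_rel_norm p q n%:~R.
Proof.
move=> n0 qn cn hn.
have n0' : (0 < `|n|)%N by rewrite absz_gt0.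
have [B [B0 Bn pB qB [h1 h2 h3 [t h4]]]] := norm_up_to_twisted n0' qn hn.
have qN : ~~ (q%:Z %| (-1)%R)%Z.
  by rewrite dvdzE /= dvdn1; have := prime_gt1 q_pr; case: (q) => [|[]].
have {h1} h1 : is_rel_norm p q (n%:~R * B%:R).
  have [h|h] := ger0P n.
    by move: h1; rewrite natrM pmulrn gez0_abs.
  move: (rel_normM (rel_normN1 p q_pr q4) h1).
  by rewrite natrM mulrA pmulrn ltz0_abs // mulrNz mulN1r opprK.
have cB : quad_char q B%:Z.
  have : quad_char q (n * B%:Z).
    have [h|h] := ger0P n; first by move: h2; rewrite PoszM gez0_abs.
    move: h2; rewrite PoszM ltz0_abs // -mulN1r -mulrA quad_charM ?quad_charN1 //.
      by rewrite Euclid_dvdzM // negb_or qn dvdzE.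
  by rewrite quad_charM ?dvdzE // cn => /eqP <-.
have nB := twisted_norm B0 pB qB (etrans h3 cB) cB h4.
have B0' : B%:R != 0 :> algC by rewrite pnatr_eq0 -lt0n.
have -> : n%:~R = n%:~R * B%:R * B%:R / B%:R ^+ 2 :> algC by field.
by apply: rel_norm_divr_sqr; [apply: Qadjoin_nat|apply: rel_normM].
Qed.
End NormCriterion.

(** * alpha is a norm from k(sqrt p3) *)

Lemma prime_dvd_gcd3 (l : nat) (x y z : int) : prime l -> gcdz (gcdz x y) z = 1 ->
  (l%:Z %| x)%Z -> (l%:Z %| y)%Z -> (l%:Z %| z)%Z -> False.
Proof.
move=> l_pr g lx ly lz; have : (l%:Z %| gcdz (gcdz x y) z)%Z by rewrite !dvdz_gcd lx ly.
by rewrite g dvdzE /= dvdn1 => /eqP l1; move: l_pr; rewrite l1.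
Qed.

Lemma inverse_mod_prime (l : nat) (a : int) : prime l -> ~~ (l%:Z %| a)%Z ->
  exists b : int, (l%:Z %| a * b - 1)%Z.
Proof.
move=> l_pr la; have [u [v e]] := Bezoutz l%:Z a.
have g1 : gcdz l%:Z a = 1.
  by congr Posz; apply/eqP; rewrite -[_ == _]/(coprime l `|a|) prime_coprime // -dvdzE.
by exists v; rewrite -g1 -e; apply/dvdzP; exists (- u); ring.
Qed.

Lemma sqrt_mod_quotient (l : nat) (a s d : int) : prime l -> ~~ (l%:Z %| a)%Z ->
  (l%:Z %| s ^+ 2 - d * a ^+ 2)%Z -> exists t : int, (l%:Z %| t ^+ 2 - d)%Z.
Proof.
move=> l_pr /(inverse_mod_prime l_pr)[b lb] ls; exists (s * b).
have -> : (s * b) ^+ 2 - d = (s ^+ 2 - d * a ^+ 2) * b ^+ 2 + (a * b - 1) * (d * (a * b + 1))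
  by ring.
by rewrite rpredD ?dvdz_mulr.
Qed.

Lemma logn_ndvdz (l : nat) (a : int) : ~~ (l%:Z %| a)%Z -> logn l `|a| = 0%N.
Proof. by rewrite dvdzE => la; rewrite lognE (negbTE la) !andbF. Qed.

(** When p q is not a square mod l, the form is anisotropic mod l: if l divides a value it divides A
    and B, so l^2 can be removed and the argument repeated. *)
Lemma logn_binary_form_even (l p q : nat) (A B : int) : prime l -> ~~ (l %| p)%N -> ~~ (l %| q)%N ->
  ~ (exists t : int, (l%:Z %| t ^+ 2 - (p * q)%:Z)%Z) ->
  ~~ odd (logn l `|(p%:Z * A ^+ 2 - q%:Z * B ^+ 2)%R|).
Proof.
move=> l_pr lp lq nt; move em : (absz _) => m; elim/ltn_ind: m A B em => m IH A B em.
(* The value zero satisfies the claim because [logn l 0] is 0. *)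
have [->|m0] := posnP m; first by rewrite logn0.
have [lm|lm] := boolP (l %| m)%N; last by rewrite lognE (negbTE lm) !andbF.
have lM : (l%:Z %| p%:Z * A ^+ 2 - q%:Z * B ^+ 2)%Z by rewrite dvdzE em.
have lA : (l%:Z %| A)%Z.
  apply/negPn/negP => lA; apply: nt; apply: (sqrt_mod_quotient l_pr lA (s := q%:Z * B)).
  have -> : (q%:Z * B) ^+ 2 - (p * q)%:Z * A ^+ 2 = - (q%:Z * (p%:Z * A ^+ 2 - q%:Z * B ^+ 2)).
    by rewrite PoszM; ring.
  by rewrite rpredN dvdz_mull.
have lB : (l%:Z %| B)%Z.
  have : (l%:Z %| q%:Z * B ^+ 2)%Z.
    have -> : q%:Z * B ^+ 2 = p%:Z * A ^+ 2 - (p%:Z * A ^+ 2 - q%:Z * B ^+ 2) by ring.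
    by rewrite rpredB // dvdz_mull // Euclid_dvdzX2.
  by rewrite Euclid_dvdzM // [X in X || _]dvdzE (negbTE lq) /= Euclid_dvdzX2.
case/dvdzP: lA => A' eA; case/dvdzP: lB => B' eB.
pose m' := `|(p%:Z * A' ^+ 2 - q%:Z * B' ^+ 2)%R|%N.
have e : m = (m' * l ^ 2)%N.
  rewrite -em /m' eA eB.
  have -> : p%:Z * (A' * l%:Z) ^+ 2 - q%:Z * (B' * l%:Z) ^+ 2 =
    (p%:Z * A' ^+ 2 - q%:Z * B' ^+ 2) * l%:Z ^+ 2 by ring.
  by rewrite abszM abszX.
have m'0 : (0 < m')%N by move: m0; rewrite e muln_gt0 => /andP[].
have l20 : (0 < l ^ 2)%N by rewrite expn_gt0 prime_gt0.
rewrite e (lognM _ m'0 l20) (lognX l l 2) oddD oddM /= addbF.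
apply: (IH m' _ A' B') => //.
by rewrite e ltn_Pmulr // -(exp1n 2) ltn_exp2r // prime_gt1.
Qed.

Section AlphaIsNorm.
Variables (p1 p2 p3 : nat) (x y z : int).
Hypotheses (pr1 : prime p1) (pr2 : prime p2) (pr3 : prime p3).
Hypotheses (n13 : p1 != p3) (n23 : p2 != p3).
Hypotheses (m1 : (p1 = 5 %[mod 8])%N) (m3 : (p3 = 1 %[mod 4])%N).
Hypotheses (sq31 : exists t : int, (p1%:Z %| t ^+ 2 - p3%:Z)%Z).
Hypotheses (sq32 : exists t : int, (p2%:Z %| t ^+ 2 - p3%:Z)%Z).
Hypotheses (exyz : x ^+ 2 - p1%:Z * y ^+ 2 - p2%:Z * z ^+ 2 = 0).
Hypothesis z_p2 : forall l, prime l -> (l%:Z %| z)%Z -> l = p2.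

Section FixedSign.
Variables (u v w : int).
Hypotheses (euvw : u ^+ 2 - p3%:Z * v ^+ 2 - p2%:Z * w ^+ 2 = 0).
Hypotheses (guvw : gcdz (gcdz u v) w = 1).
Hypothesis p3n : ~~ (p3%:Z %| 2 * w * (x * w + u * z))%Z.
Let n := 2 * w * (x * w + u * z).

(* If neither p3 nor p1 p3 is a square mod l, then l does not divide both xw + uz and xw - uz, and
   the product p1 (yw)^2 - p3 (vz)^2 of these has even valuation at l. *)
Lemma multiplier_odd_primes l : prime l -> odd (logn l `|n|) ->
  split_prime p3 l \/ twisted_prime p1 p3 l.
Proof.
move=> l_pr ol.
have ln : (l%:Z %| n)%Z.
  by rewrite dvdzE; apply: contraTT ol => h; rewrite lognE (negbTE h) !andbF.
have n0 : n != 0 by apply: contraNneq p3n => h; rewrite -/n h dvdz0.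
have l3 : l != p3 by apply: contraNneq p3n => <-.
(* As p1 = 5 mod 8 and p3 is 1 or 5 mod 8, one of p3 and p1 p3 is 1 mod 8, so 2 is always split or
   twisted. *)
have [l2|l2] := eqVneq l 2%N.
  have [h|h] : (p3 = 1 %[mod 8])%N \/ (p3 = 5 %[mod 8])%N by move: m3; clear; lia.
    left; split=> //; exists 1; rewrite l2; move: h; clear; lia.
  right; split=> //; first by rewrite l2; apply: contra_eqN m1 => /eqP <-.
    by move=> _; rewrite -modnMm m1 h.
  have h8 : (p1 * p3 = 1 %[mod 8])%N by rewrite -modnMm m1 h.
  by exists 1; rewrite l2; move: (p1 * p3)%N h8; clear; lia.
have [s3|s3] := pselect (exists t : int, (l%:Z %| t ^+ 2 - p3%:Z)%Z); first by left;
  split=> // /eqP; rewrite (negbTE l2).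
have l1 : l != p1 by apply/eqP => e; apply: s3; rewrite e.
have lp2 : l != p2 by apply/eqP => e; apply: s3; rewrite e.
have [s13|s13] := pselect (exists t : int, (l%:Z %| t ^+ 2 - (p1 * p3)%:Z)%Z).
  by right; split=> // /eqP; rewrite (negbTE l2).
exfalso.
have lP (q : nat) : prime q -> l != q -> (l%:Z %| q%:Z)%Z = false.
  by move=> q_pr lq; apply: negbTE; rewrite prime_dvdzN.
have lz : ~~ (l%:Z %| z)%Z by apply: contra lp2 => /(z_p2 l_pr) ->.
have lw : ~~ (l%:Z %| w)%Z.
  apply/negP => lw; apply: s3.
  have [lv|lv] := boolP (l%:Z %| v)%Z.
    case: (prime_dvd_gcd3 l_pr guvw _ lv lw); rewrite -Euclid_dvdzX2 //.
    have -> : u ^+ 2 = p3%:Z * v ^+ 2 + p2%:Z * w ^+ 2 by move: euvw; clear; lia.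
    by rewrite rpredD // dvdz_mull // Euclid_dvdzX2.
  apply: (sqrt_mod_quotient l_pr lv (s := u)).
  have -> : u ^+ 2 - p3%:Z * v ^+ 2 = p2%:Z * w ^+ 2 by move: euvw; clear; lia.
  by rewrite dvdz_mull // Euclid_dvdzX2.
have l2' : ~~ (l%:Z %| 2)%Z by rewrite dvdzE dvdn_prime2.
pose m := x * w + u * z; pose m' := x * w - u * z.
have logm : logn l `|n| = logn l `|m|.
  have h : (0 < `|m|)%N by rewrite absz_gt0; apply: contra n0 => /eqP h; rewrite /n -/m h mulr0.
  have h' : (0 < `|(2 * w)%R|)%N by rewrite absz_gt0; apply: contra n0 => /eqP h';
    rewrite /n h' mul0r.
  rewrite /n -/m abszM (lognM _ h' h) [X in (X + _)%N]logn_ndvdz //.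
  by rewrite Euclid_dvdzM // negb_or l2'.
have mm' : m * m' = p1%:Z * (y * w) ^+ 2 - p3%:Z * (v * z) ^+ 2.
  rewrite /m /m'.
  have ex : x ^+ 2 = p1%:Z * y ^+ 2 + p2%:Z * z ^+ 2 by move: exyz; clear; lia.
  have eu : u ^+ 2 = p3%:Z * v ^+ 2 + p2%:Z * w ^+ 2 by move: euvw; clear; lia.
  have -> : (x * w + u * z) * (x * w - u * z) = x ^+ 2 * w ^+ 2 - u ^+ 2 * z ^+ 2 by ring.
  by rewrite ex eu; ring.
have [lm'|lm'] := boolP (l%:Z %| m')%Z; last first.
  have : ~~ odd (logn l `|(m * m')%R|).
    rewrite mm'; apply: logn_binary_form_even => //; first by rewrite dvdn_prime2.
    by rewrite dvdn_prime2.
  have h : (0 < `|m|)%N by rewrite absz_gt0; apply: contra n0 => /eqP h; rewrite /n -/m h mulr0.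
  have h' : (0 < `|m'|)%N by rewrite absz_gt0; apply: contra lm' => /eqP ->; rewrite dvdz0.
  rewrite abszM (lognM _ h h') -logm [X in (_ + X)%N]logn_ndvdz // addn0.
  by rewrite ol.
have lm : (l%:Z %| m)%Z.
  by move: ln; rewrite /n -/m Euclid_dvdzM // Euclid_dvdzM // (negbTE l2') (negbTE lw).
have lx : (l%:Z %| x)%Z.
  have : (l%:Z %| 2 * w * x)%Z.
    by have -> : 2 * w * x = m + m' by [rewrite /m /m'; ring|]; rewrite rpredD.
  by rewrite !Euclid_dvdzM // (negbTE l2') (negbTE lw).
have lu : (l%:Z %| u)%Z.
  have : (l%:Z %| 2 * z * u)%Z.
    by have -> : 2 * z * u = m - m' by [rewrite /m /m'; ring|]; rewrite rpredB.
  by rewrite !Euclid_dvdzM // (negbTE l2') (negbTE lz).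
have lpz : ~~ (l%:Z %| p2%:Z * z ^+ 2)%Z by rewrite Euclid_dvdzM // Euclid_dvdzX2 // lP.
have lpw : ~~ (l%:Z %| p2%:Z * w ^+ 2)%Z by rewrite Euclid_dvdzM // Euclid_dvdzX2 // lP.
have ly : ~~ (l%:Z %| y)%Z.
  apply: contra lpz => ly; have -> : p2%:Z * z ^+ 2 = x ^+ 2 - p1%:Z * y ^+ 2 by move: exyz;
    clear; lia.
  by rewrite rpredB ?dvdz_mull // Euclid_dvdzX2.
have lv : ~~ (l%:Z %| v)%Z.
  apply: contra lpw => lv; have -> : p2%:Z * w ^+ 2 = u ^+ 2 - p3%:Z * v ^+ 2 by move: euvw;
    clear; lia.
  by rewrite rpredB ?dvdz_mull // Euclid_dvdzX2.
(* Modulo l both x and u vanish, so p2 z^2 = - p1 y^2 and p2 w^2 = - p3 v^2; multiplying shows that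
   p1 p3 (y v)^2 is the square of p2 z w. *)
apply: s13; apply: (sqrt_mod_quotient l_pr (a := y * v) (s := p2%:Z * z * w)).
  by rewrite Euclid_dvdzM // negb_or ly.
have -> : (p2%:Z * z * w) ^+ 2 = (p2%:Z * z ^+ 2) * (p2%:Z * w ^+ 2) by ring.
have -> : p2%:Z * z ^+ 2 = x ^+ 2 - p1%:Z * y ^+ 2 by move: exyz; clear; lia.
have -> : p2%:Z * w ^+ 2 = u ^+ 2 - p3%:Z * v ^+ 2 by move: euvw; clear; lia.
have -> : (x ^+ 2 - p1%:Z * y ^+ 2) * (u ^+ 2 - p3%:Z * v ^+ 2) - (p1 * p3)%:Z * (y * v) ^+ 2
  = x * (x * (u ^+ 2 - p3%:Z * v ^+ 2)) - u * (u * (p1%:Z * y ^+ 2)) by rewrite PoszM; ring.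
by rewrite rpredB ?dvdz_mulr.
Qed.

(* With a = x + y e = c^2 mod p3, one has (w a + z u)^2 = a n mod p3. *)
Lemma multiplier_char (e c : int) : (p3%:Z %| e ^+ 2 - p1%:Z)%Z ->
  (p3%:Z %| x + y * e - c ^+ 2)%Z -> quad_char p3 n.
Proof.
move=> he hc; pose a := x + y * e.
have ex : p2%:Z * z ^+ 2 = x ^+ 2 - p1%:Z * y ^+ 2 by move: exyz; clear; lia.
have eu : u ^+ 2 = p3%:Z * v ^+ 2 + p2%:Z * w ^+ 2 by move: euvw; clear; lia.
have pc : ~~ (p3%:Z %| c)%Z.
  apply/negP => pc.
  have pa : (p3%:Z %| a)%Z.
    have -> : a = (x + y * e - c ^+ 2) + c * c by rewrite /a; ring.
    by rewrite rpredD // dvdz_mulr.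
  have : (p3%:Z %| p2%:Z * z ^+ 2)%Z.
    rewrite ex; have -> : x ^+ 2 - p1%:Z * y ^+ 2 = a * (x - y * e) + (e ^+ 2 - p1%:Z) * y ^+ 2.
      by rewrite /a; ring.
    by rewrite rpredD ?dvdz_mulr.
  rewrite Euclid_dvdzM // Euclid_dvdzX2 //.
  have -> : (p3%:Z %| p2%:Z)%Z = false by apply: negbTE; rewrite prime_dvdzN // eq_sym.
  by move/(z_p2 pr3)/eqP; rewrite eq_sym (negbTE n23).
have : quad_char p3 (c * c * n).
  apply/(quad_charP pr3 m3);
    first by rewrite Euclid_dvdzM // negb_or p3n andbT Euclid_dvdzM // negb_or pc.
  exists (w * a + z * u).
  have -> : (w * a + z * u) ^+ 2 - c * c * n = w ^+ 2 * a ^+ 2 + 2 * w * a * z * u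
      + z ^+ 2 * u ^+ 2 - c * c * n by ring.
  rewrite eu.
  have -> : w ^+ 2 * a ^+ 2 + 2 * w * a * z * u + z ^+ 2 * (p3%:Z * v ^+ 2 + p2%:Z * w ^+ 2)
    - c * c * n
     = w ^+ 2 * a ^+ 2 + 2 * w * a * z * u + p3%:Z * (z ^+ 2 * v ^+ 2)
      + w ^+ 2 * (p2%:Z * z ^+ 2) - c * c * n by ring.
  rewrite ex.
  have -> : w ^+ 2 * a ^+ 2 + 2 * w * a * z * u + p3%:Z * (z ^+ 2 * v ^+ 2)
      + w ^+ 2 * (x ^+ 2 - p1%:Z * y ^+ 2) - c * c * n =
      (x + y * e - c ^+ 2) * n + p3%:Z * (z ^+ 2 * v ^+ 2)
      + (e ^+ 2 - p1%:Z) * (w ^+ 2 * y ^+ 2) by rewrite /a /n; ring.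
  by rewrite !rpredD ?dvdz_mulr.
rewrite quad_charM //; last by rewrite Euclid_dvdzM // negb_or pc.
by rewrite quad_charM // eqxx => /eqP <-.
Qed.

Lemma multiplier_rel_norm (e c : int) : (p3%:Z %| e ^+ 2 - p1%:Z)%Z ->
  (p3%:Z %| x + y * e - c ^+ 2)%Z -> is_rel_norm p1 p3 (redei_alpha p1 x y).
Proof.
move=> he hc.
have n0 : n != 0 by apply: contraNneq p3n => h; rewrite -/n h dvdz0.
have m1' : (p1 = 1 %[mod 4])%N by move: m1; clear; lia.
have Nn : is_rel_norm p1 p3 n%:~R.
  apply: rel_norm_criterion => //; first exact: multiplier_char he hc.
  exact: multiplier_odd_primes.
set al := redei_alpha p1 x y.
have kal : Qadjoin [:: sqrtC p1%:R] al.
  apply: QadjoinD; first exact: Qadjoin_int.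
  apply: QadjoinM; first exact: Qadjoin_int.
  by apply: Qadjoin_gen; rewrite inE.
have Nan : is_rel_norm p1 p3 (al * n%:~R).
  exists (w%:~R * al + z%:~R * u%:~R), (z%:~R * v%:~R); split.
  - by apply: QadjoinD; apply: QadjoinM => //; apply: Qadjoin_int.
  - by apply: QadjoinM; apply: Qadjoin_int.
  have e2 : p3%:R * (v%:~R * v%:~R) = u%:~R * u%:~R - p2%:R * (w%:~R * w%:~R) :> algC.
    by rewrite !pmulrn -!intrM -intrB; congr (_%:~R); move: euvw; clear; lia.
  have e1 : p2%:R * (z%:~R * z%:~R) = x%:~R * x%:~R - p1%:R * (y%:~R * y%:~R) :> algC.
    by rewrite !pmulrn -!intrM -intrB; congr (_%:~R); move: exyz; clear; lia.
  have en : n%:~R = 2%:R * w%:~R * (x%:~R * w%:~R + u%:~R * z%:~R) :> algC.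
    by rewrite pmulrn -!intrM -intrD -intrM.
  have es : sqrtC p1%:R * sqrtC p1%:R = p1%:R :> algC by rewrite -expr2 sqrtCK.
  have -> : (w%:~R * al + z%:~R * u%:~R) ^+ 2 - p3%:R * (z%:~R * v%:~R) ^+ 2
    = (w%:~R * al + z%:~R * u%:~R) ^+ 2 - z%:~R ^+ 2 * (p3%:R * (v%:~R * v%:~R)) by ring.
  rewrite e2.
  have -> : (w%:~R * al + z%:~R * u%:~R) ^+ 2 -
    z%:~R ^+ 2 * (u%:~R * u%:~R - p2%:R * (w%:~R * w%:~R)) =
    w%:~R ^+ 2 * al ^+ 2 + 2%:R * w%:~R * al * z%:~R * u%:~R
    + w%:~R ^+ 2 * (p2%:R * (z%:~R * z%:~R)) by ring.
  by rewrite e1 en -es /al /redei_alpha; ring.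
have n0' : n%:~R != 0 :> algC by rewrite intr_eq0.
have -> : al = al * n%:~R * n%:~R / n%:~R ^+ 2 by field.
by apply: rel_norm_divr_sqr; [apply: Qadjoin_int|apply: rel_normM].
Qed.
End FixedSign.

(** The sign of u is settled here: p3 divides none of 2, u and z, so it cannot divide both x w + u z
    and x w - u z. *)
Lemma redei_alpha_rel_norm (u v w e c : int) :
  u ^+ 2 - p3%:Z * v ^+ 2 - p2%:Z * w ^+ 2 = 0 -> gcdz (gcdz u v) w = 1 ->
  (p3%:Z %| e ^+ 2 - p1%:Z)%Z -> (p3%:Z %| x + y * e - c ^+ 2)%Z ->
  is_rel_norm p1 p3 (redei_alpha p1 x y).
Proof.
move=> euvw guvw he hc.
have p32 : ~~ (p3%:Z %| 2)%Z.
  by rewrite dvdzE /= dvdn_prime2 //; apply/eqP => h; move: m3; rewrite h.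
have p3p2 : ~~ (p3%:Z %| p2%:Z)%Z by rewrite prime_dvdzN // eq_sym.
have eu : p2%:Z * w ^+ 2 = u ^+ 2 - p3%:Z * v ^+ 2 by move: euvw; clear; lia.
have p3w : ~~ (p3%:Z %| w)%Z.
  apply/negP => p3w; have p3u : (p3%:Z %| u)%Z.
    rewrite -Euclid_dvdzX2 //; have -> : u ^+ 2 = p3%:Z * v ^+ 2 + p2%:Z * (w * w) by move: euvw;
      clear; lia.
    by apply: rpredD; [exact: dvdz_mulr | rewrite mulrA; exact: dvdz_mull].
  (* Here p3^2 divides u^2 - p2 w^2 = p3 v^2, so p3 divides v as well. *)
  case: (prime_dvd_gcd3 pr3 guvw p3u _ p3w); case/dvdzP: p3u => u' eu'; case/dvdzP: p3w => w' ew'.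
  rewrite -Euclid_dvdzX2 //; apply/dvdzP; exists (u' ^+ 2 - p2%:Z * w' ^+ 2).
  have p30 : p3%:Z != 0 by rewrite -lt0n prime_gt0.
  apply: (mulfI p30); move: euvw; rewrite eu' ew' => h; apply/eqP;
    rewrite eq_sym -subr_eq0 -[X in _ == X]h.
  by apply/eqP; ring.
have p3u : ~~ (p3%:Z %| u)%Z.
  apply/negP => p3u; have : (p3%:Z %| p2%:Z * w ^+ 2)%Z.
    by rewrite eu rpredB ?dvdz_mulr // Euclid_dvdzX2.
  by rewrite Euclid_dvdzM // Euclid_dvdzX2 // (negbTE p3p2) (negbTE p3w).
have p3z : ~~ (p3%:Z %| z)%Z by apply: contra n23 => /(z_p2 pr3) ->.
have [hp|hp] := boolP (p3%:Z %| x * w + u * z)%Z; last first.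
  apply: (multiplier_rel_norm euvw guvw _ he hc).
  by rewrite !Euclid_dvdzM // (negbTE p32) (negbTE p3w) (negbTE hp).
apply: (@multiplier_rel_norm (- u) v w _ _ _ e c) => //.
- by rewrite sqrrN.
- by rewrite gcdNz.
rewrite !Euclid_dvdzM // (negbTE p32) (negbTE p3w) /=; apply/negP => hm.
have : (p3%:Z %| 2 * u * z)%Z.
  have -> : 2 * u * z = (x * w + u * z) - (x * w + - u * z) by ring.
  by rewrite rpredB.
by rewrite !Euclid_dvdzM // (negbTE p32) (negbTE p3u) (negbTE p3z).
Qed.
End AlphaIsNorm.

(** * Integers of Q(sqrt p) and class number one *)

Lemma rat_sqr_mul_prime_int (p : nat) (r : rat) : prime p ->
  p%:R * r ^+ 2 \is a Num.int -> r \is a Num.int.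
Proof.
move=> p_pr /intrP[M eM]; set n := numq r; set d := denq r.
have d0 : d%:~R != 0 :> rat by rewrite intr_eq0 denq_neq0.
have e : p%:Z * n ^+ 2 = M * d ^+ 2.
  apply/eqP; rewrite -(eqr_int rat) !expr2 !intrM -pmulrn -eM.
  by rewrite -{1}(divq_num_den r) -/n -/d; apply/eqP; field.
have cop : coprime `|d| `|n| by rewrite coprime_sym; apply: coprime_num_den.
have e' : (p * `|n| ^ 2 = `|M| * `|d| ^ 2)%N.
  by move: (congr1 absz e); rewrite !expr2 !abszM -!mulnn.
have : (`|d| %| p)%N.
  rewrite -(@Gauss_dvdl _ _ (`|n| ^ 2)) ?coprimeXr // e' -mulnn mulnA dvdn_mull //.
case/primeP: (p_pr) => _ H /H/orP[] /eqP d1.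
  apply/intrP; exists n; rewrite -[LHS]divq_num_den -/n -/d.
  by have -> : d = 1; [move: d1 (denq_gt0 r); rewrite -/d; clear; lia|rewrite divr1].
have : (p %| `|n| ^ 2)%N.
  rewrite -(dvdn_pmul2l (prime_gt0 p_pr)) e' d1 mulnn dvdn_mull //.
rewrite Euclid_dvdX // => /andP[pn _]; move: cop; rewrite d1 prime_coprime //.
by rewrite pn.
Qed.

(** One shape for all the integrality proofs: a quadratic equation is brought to it by
    multiplication by x^2. *)
Lemma Aint_quartic (a b c d : int) (x : algC) :
  x ^+ 4 + a%:~R * x ^+ 3 + b%:~R * x ^+ 2 + c%:~R * x + d%:~R = 0 -> x \in Aint.
Proof.
move=> e; pose Q : {poly algC} := \poly_(i < 4) (nth 0 [:: d; c; b; a] i)%:~R.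
have sQ : (size Q < size ('X^4 : {poly algC}))%N by rewrite size_polyXn ltnS size_poly.
apply: (@root_monic_Aint ('X^4 + Q)).
- rewrite /root hornerD hornerXn horner_poly !big_ord_recr big_ord0 /= add0r expr0 expr1 mulr1.
  by rewrite -[X in _ == X]e; apply/eqP; ring.
- by rewrite monicE lead_coefDl // lead_coefXn.
- apply/polyOverP => i; rewrite coefD coefXn coef_poly.
  by apply: rpredD; [apply: natr_int|case: ifP => _; [apply: intr_int|apply: rpred0]].
Qed.

Definition quad_omega (p : nat) : algC := (1 + sqrtC p%:R) / 2%:R.
(* The constant term of the minimal polynomial T^2 - T - c of quad_omega. *)
Definition quad_const (p : nat) : int := (p.-1 %/ 4)%N.

Definition zomega (p : nat) (a b : int) : algC := a%:~R + b%:~R * quad_omega p.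
Definition zomega_norm (p : nat) (a b : int) : int := a ^+ 2 + a * b - quad_const p * b ^+ 2.

(* The coordinates of l^2 - u * a on the basis (1, omega), for l = (l1, l2), u = (u1, u2)
   and a = (a, b), when omega^2 = omega + c. *)
Definition sqr_sub_mul1 (c a b u1 u2 l1 l2 : int) : int :=
  l1 ^+ 2 + c * l2 ^+ 2 - u1 * a - c * u2 * b.
Definition sqr_sub_mul2 (a b u1 u2 l1 l2 : int) : int :=
  2 * l1 * l2 + l2 ^+ 2 - u1 * b - u2 * a - u2 * b.

Definition residues4 : seq int := [:: 0; 1; 2; 3].

(** With eps = e + f omega, one of 1, -1, eps, -eps times a + b omega is a square modulo 4. *)
Definition unit_square_test (c a b e f : int) : bool :=
  has (fun u => has (fun l1 => has (fun l2 =>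
    (4 %| sqr_sub_mul1 c a b u.1 u.2 l1 l2)%Z && (4 %| sqr_sub_mul2 a b u.1 u.2 l1 l2)%Z)
    residues4) residues4) [:: (1, 0); (-1, 0); (e, f); (- e, - f)].

(** A check of all 4^5 residue tuples. The three escape clauses negate the hypotheses: c odd (2 is
    inert), a + b omega prime to 2, and eps of norm -1 modulo 4. *)
Lemma unit_square_testP : all (fun c => all (fun a => all (fun b => all (fun e => all (fun f =>
  [|| (2 %| c)%Z, (2 %| a)%Z && (2 %| b)%Z, ~~ (4 %| e ^+ 2 + e * f - c * f ^+ 2 + 1)%Z
    | unit_square_test c a b e f]) residues4) residues4) residues4) residues4) residues4.
Proof. by vm_compute. Qed.

Lemma mem_residue4 (a : int) : (a %% 4)%Z \in residues4.
Proof. by rewrite !inE; clear; lia. Qed.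

(** The conditions are polynomial, so they pass from residues to integers. The multiplier is lifted
    to exactly one of the four listed pairs, since an element merely congruent to a unit need not be
    one. *)
Lemma unit_square_mod4 (c a b e f : int) : ~~ (2 %| c)%Z -> ~~ ((2 %| a)%Z && (2 %| b)%Z) ->
  e ^+ 2 + e * f - c * f ^+ 2 = -1 ->
  exists u1 u2 l1 l2 : int,
    (u1, u2) \in [:: (1, 0); (-1, 0); (e, f); (- e, - f)] /\
    (4 %| sqr_sub_mul1 c a b u1 u2 l1 l2)%Z /\ (4 %| sqr_sub_mul2 a b u1 u2 l1 l2)%Z.
Proof.
move=> c2 ab2 nef.
have red (i : int) : exists r : int, [/\ r \in residues4 & (4 %| i - r)%Z].
  by exists (i %% 4)%Z; split; [apply: mem_residue4|clear; lia].
have [c' [hc ec]] := red c; have [a' [ha ea]] := red a; have [b' [hb eb]] := red b.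
have [e' [he ee]] := red e; have [f' [hf ef]] := red f.
have /allP/(_ _ hc)/allP/(_ _ ha)/allP/(_ _ hb)/allP/(_ _ he)/allP/(_ _ hf) := unit_square_testP.
have -> : (2 %| c')%Z = false by move: c2 ec; clear; lia.
have -> : (2 %| a')%Z && (2 %| b')%Z = false by move: ab2 ea eb; clear; lia.
have -> : (4 %| e' ^+ 2 + e' * f' - c' * f' ^+ 2 + 1)%Z.
  have -> : e' ^+ 2 + e' * f' - c' * f' ^+ 2 + 1 = (e ^+ 2 + e * f - c * f ^+ 2 + 1) -
    ((e - e') * (e + e' + f) + (f - f') * e' - (c - c') * f ^+ 2 - (f - f') * (c' * (f + f')))
      by ring.
  by rewrite nef addNr sub0r rpredN !rpredB // ?rpredD // dvdz_mulr.
case/hasP => -[v1 v2] hv /hasP[l1 _ /hasP[l2 _ /andP[/= h1 h2]]].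
have [u1 [u2 [hu hu1 hu2]]] : exists u1 u2 : int, [/\ (u1, u2) \in [:: (1, 0); (-1, 0); (e, f);
  (- e, - f)],
    (4 %| u1 - v1)%Z & (4 %| u2 - v2)%Z].
  move: hv; rewrite !inE => /or4P[]/eqP[-> ->].
  - by exists 1, 0; rewrite !inE eqxx !subrr !dvdz0.
  - by exists (-1), 0; rewrite !inE eqxx orbT !subrr !dvdz0.
  - by exists e, f; rewrite !inE eqxx !orbT.
  - exists (- e), (- f); rewrite !inE eqxx !orbT; split=> //.
    + by have -> : - e - - e' = - (e - e') by [ring|]; rewrite rpredN.
    + by have -> : - f - - f' = - (f - f') by [ring|]; rewrite rpredN.
exists u1, u2, l1, l2; split=> //; split.
- have -> : sqr_sub_mul1 c a b u1 u2 l1 l2 = sqr_sub_mul1 c' a' b' v1 v2 l1 l2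
    - (u1 - v1) * a - (a - a') * v1 + (c - c') * (l2 ^+ 2 - u2 * b)
    - (u2 - v2) * (c' * b) - (b - b') * (c' * v2) by rewrite /sqr_sub_mul1; ring.
  by do 5 (first [apply: rpredB|apply: rpredD]; last by apply: dvdz_mulr).
- have -> : sqr_sub_mul2 a b u1 u2 l1 l2 = sqr_sub_mul2 a' b' v1 v2 l1 l2
    - (u1 - v1) * b - (b - b') * v1 - (u2 - v2) * a - (a - a') * v2
    - (u2 - v2) * b - (b - b') * v2 by rewrite /sqr_sub_mul2; ring.
  by do 6 (apply: rpredB; last by apply: dvdz_mulr).
Qed.

Section QuadraticIntegers.
Variable p : nat.
Hypotheses (p_pr : prime p) (p_mod8 : (p = 5 %[mod 8])%N).
Local Notation k := (Qadjoin [:: sqrtC p%:R]).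
Local Notation Ok := (integers_of k).
Local Notation rt := (sqrtC p%:R : algC).
Local Notation om := (quad_omega p).
Local Notation c0 := (quad_const p).

Let two0 : 2%:R != 0 :> algC. Proof. by rewrite pnatr_eq0. Qed.

Let rt2 : rt ^+ 2 = p%:R. Proof. exact: sqrtCK. Qed.

Let pE : p%:Z = 4 * c0 + 1.
Proof. by rewrite /quad_const; move: p_mod8; clear; lia. Qed.

Let c0_odd : exists c : int, c0 = 2 * c + 1.
Proof. by exists (p.-1 %/ 8)%N; rewrite /quad_const; move: p_mod8; clear; lia. Qed.

Let om2 : om ^+ 2 = om + c0%:~R.
Proof.
have : p%:R = 4%:R * c0%:~R + 1 :> algC by rewrite pmulrn pE intrD intrM.
rewrite -rt2 /quad_omega => e;
  have -> : ((1 + rt) / 2%:R) ^+ 2 = (1 + 2%:R * rt + rt ^+ 2) / 4%:R by field.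
by rewrite e; field.
Qed.

Let krt : k rt. Proof. by apply: Qadjoin_gen; rewrite inE. Qed.

Let kom : k om.
Proof.
by apply: Qadjoin_div; [apply: QadjoinD => //; apply: Qadjoin1|apply: Qadjoin_nat].
Qed.

Lemma sqrt_prime_indep (a b : rat) : ratr a + ratr b * rt = 0 -> a = 0 /\ b = 0.
Proof.
move=> e; have b0 : b = 0.
  apply/eqP/negPn/negP => b0; pose r := a / b.
  have r2 : r ^+ 2 = p%:R.
    apply: (fmorph_inj (@ratr algC)); rewrite rmorphXn fmorph_div /= ratr_nat -rt2.
    have -> : ratr a = - (ratr b * rt) :> algC by apply/eqP; rewrite -addr_eq0 e.
    by have h : ratr b != 0 :> algC by [rewrite fmorph_eq0|]; field.
  have d0 : (denq r)%:~R != 0 :> rat by rewrite intr_eq0 denq_neq0.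
  have : numq r ^+ 2 = p%:Z * denq r ^+ 2.
    apply/eqP; rewrite -(eqr_int rat) !expr2 !intrM -pmulrn -r2.
    by rewrite -{3}(divq_num_den r); apply/eqP; field.
  by move/(sqrz_mul_square (denq_neq0 r)); apply: prime_not_square.
split=> //; move/eqP: e; rewrite b0 rmorph0 mul0r addr0 fmorph_eq0.
by move/eqP.
Qed.

(** A rational polynomial takes conjugate values A + B sqrt p and A - B sqrt p at the two numbers,
    so they are roots of the same minimal polynomial. *)
Lemma Aint_conj (a b : rat) : ratr a + ratr b * rt \in Aint -> ratr a - ratr b * rt \in Aint.
Proof.
set x := ratr a + _; set y := ratr a - _ => xA.
have ev (P : {poly rat}) : exists A B : rat,
    (map_poly ratr P).[x] = ratr A + ratr B * rt /\ (map_poly ratr P).[y] = ratr A - ratr B * rt.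
  elim/poly_ind: P => [|P c [A [B [IH1 IH2]]]].
    by exists 0, 0; rewrite !rmorph0 !horner0 mul0r addr0 subr0.
  exists (A * a + B * b * p%:R + c), (A * b + B * a).
  have -> : map_poly ratr (P * 'X + c%:P) = map_poly ratr P * 'X + (ratr c)%:P :> {poly algC}.
    by rewrite rmorphD rmorphM /= map_polyX map_polyC.
  rewrite !hornerD !hornerM !hornerX !hornerC IH1 IH2 !rmorphD !rmorphM /= ratr_nat /x /y.
  by move: (sqrtC p%:R) rt2 => r <-; split; ring.
have [P [eP mP _]] := minCpolyP x.
have [A [B [e1 e2]]] := ev P.
have ry : root (minCpoly x) y.
  have : root (minCpoly x) x by apply: root_minCpoly.
  rewrite eP /root e1 => /eqP/sqrt_prime_indep[A0 B0].
  by rewrite e2 A0 B0 rmorph0 mul0r subrr.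
exact: (root_monic_Aint ry (minCpoly_monic x) xA).
Qed.

Local Notation zom := (zomega p).
Local Notation znorm := (zomega_norm p).

Lemma Aint_om : om \in Aint.
Proof.
apply: (@Aint_quartic (-1) (- c0) 0 0); have -> : om ^+ 4 = om ^+ 2 * om ^+ 2 by ring.
by have -> : om ^+ 3 = om ^+ 2 * om by [ring|]; rewrite !om2; ring.
Qed.

Lemma Ok_zom a b : Ok (zom a b).
Proof.
split; first by apply: QadjoinD; [|apply: QadjoinM => //]; apply: Qadjoin_int.
by apply: rpredD; [|apply: rpredM; [|exact: Aint_om]]; apply: Aint_int.
Qed.

(** The trace A = 2a and the norm N are integers, p (2b)^2 = A^2 - 4N makes 2b an integer B, and p =
    1 mod 4 forces A and B to have the same parity. *)
Lemma OkP x : Ok x -> exists a b : int, x = zom a b.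
Proof.
case=> /Qadjoin_sqrtP[a [b ex]] xA.
have yA : ratr a - ratr b * rt \in Aint by apply: Aint_conj; rewrite -ex.
have rat_int (q : rat) : ratr q \in Aint -> q \is a Num.int.
  move=> qA; have : ratr q \is a @Num.int algC by apply: Cint_rat_Aint => //; apply: Crat_rat.
  by case/intrP=> m; rewrite -ratr_int => /fmorph_inj ->; apply: intr_int.
have : a *+ 2 \is a Num.int.
  apply: rat_int; have -> : ratr (a *+ 2) = x + (ratr a - ratr b * rt) :> algC.
    by rewrite ex rmorphMn /=; ring.
  by rewrite rpredD.
case/intrP=> A eA.
have : a ^+ 2 - p%:R * b ^+ 2 \is a Num.int.
  apply: rat_int; have -> : ratr (a ^+ 2 - p%:R * b ^+ 2) = x * (ratr a - ratr b * rt) :> algC.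
    by rewrite ex !expr2 rmorphB !rmorphM /= ratr_nat; move: (sqrtC p%:R) rt2 => r <-; ring.
  by rewrite rpredM.
case/intrP=> N eN.
have eB' : p%:R * (b *+ 2) ^+ 2 = (A ^+ 2 - 4 * N)%:~R :> rat.
  by rewrite intrB rmorphXn /= -eA intrM -eN; ring.
have : b *+ 2 \is a Num.int.
  by apply: (rat_sqr_mul_prime_int p_pr); rewrite eB' intr_int.
case/intrP=> B eB.
have eAB : p%:Z * B ^+ 2 = A ^+ 2 - 4 * N.
  by apply/eqP; rewrite -(eqr_int rat) -eB' eB intrM rmorphXn -pmulrn.
have : (2 %| A - B)%Z.
  have : (2 %| A ^+ 2 - B ^+ 2)%Z.
    apply/dvdzP; exists (2 * N + 2 * c0 * B ^+ 2); rewrite pE in eAB.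
    have -> : A ^+ 2 = (4 * c0 + 1) * B ^+ 2 + 4 * N by rewrite eAB; ring.
    by ring.
  have -> : A ^+ 2 - B ^+ 2 = (A - B) * (A - B + 2 * B) by ring.
  rewrite (@Euclid_dvdzM 2) // => /orP[] //.
  by rewrite rpredDr // dvdz_mulr.
case/dvdzP=> D eD; exists D, B; rewrite ex /zomega /quad_omega.
have -> : ratr a = A%:~R / 2%:R :> algC.
  by rewrite -ratr_int -eA rmorphMn /=; field.
have -> : ratr b = B%:~R / 2%:R :> algC.
  by rewrite -ratr_int -eB rmorphMn /=; field.
have -> : A = D * 2 + B by rewrite -eD; ring.
by rewrite intrD intrM; field.
Qed.

Lemma zom_eq0 a b : zom a b = 0 -> a = 0 /\ b = 0.
Proof.
move=> e; have : ratr (a%:~R + b%:~R / 2%:R) + ratr (b%:~R / 2%:R) * rt = 0 :> algC.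
  by rewrite -[RHS]e rmorphD !fmorph_div /= !ratr_int ratr_nat /zomega /quad_omega; field.
case/sqrt_prime_indep => ea eb.
have b0 : b = 0.
  by apply/eqP; rewrite -(eqr_int rat); move/eqP: eb; rewrite mulf_eq0 invr_eq0 pnatr_eq0 orbF.
split=> //; apply/eqP; rewrite -(eqr_int rat); move/eqP: ea.
by rewrite b0 mul0r addr0.
Qed.

Lemma zom_inj a b c d : zom a b = zom c d -> a = c /\ b = d.
Proof.
move=> e; have : zom (a - c) (b - d) = 0.
  have -> : zom (a - c) (b - d) = zom a b - zom c d by rewrite /zomega !intrB; ring.
  by rewrite e subrr.
by case/zom_eq0 => /eqP; rewrite subr_eq0 => /eqP -> /eqP; rewrite subr_eq0 => /eqP ->.
Qed.

Lemma zomM a b c d : zom a b * zom c d = zom (a * c + c0 * b * d) (a * d + b * c + b * d).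
Proof.
rewrite /zomega !intrD !intrM.
have -> : (a%:~R + b%:~R * om) * (c%:~R + d%:~R * om) = a%:~R * c%:~R +
  (a%:~R * d%:~R + b%:~R * c%:~R) * om + b%:~R * d%:~R * om ^+ 2 by ring.
by rewrite om2; ring.
Qed.

Lemma znormM a b c d :
  znorm (a * c + c0 * b * d) (a * d + b * c + b * d) = znorm a b * znorm c d.
Proof. by rewrite /zomega_norm; ring. Qed.

(** The conjugate of omega is 1 - omega, so that of a + b omega is (a + b) - b omega. *)
Lemma zom_conj a b : zom a b * zom (a + b) (- b) = (znorm a b)%:~R.
Proof.
rewrite zomM; have -> : a * - b + b * (a + b) + b * - b = 0 by ring.
by rewrite /zomega mul0r addr0; congr (_%:~R); rewrite /zomega_norm; ring.
Qed.

(** The inertness of 2: since [quad_const p] is odd, the norm form is a^2 + a b + b^2 modulo 2,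
    which has no nontrivial zero. *)
Lemma zom_even_of_norm a b : (2 %| znorm a b)%Z -> (2 %| a)%Z /\ (2 %| b)%Z.
Proof.
have [c ec] := c0_odd; rewrite /zomega_norm ec => /dvdzP[q e].
have [b1 [rb [eb hb]]] : exists b1 rb : int, b = 2 * b1 + rb /\ (rb = 0 \/ rb = 1).
  by exists (b %/ 2)%Z, (b %% 2)%Z; clear; lia.
have [a1 [ra [ea ha]]] : exists a1 ra : int, a = 2 * a1 + ra /\ (ra = 0 \/ ra = 1).
  by exists (a %/ 2)%Z, (a %% 2)%Z; clear; lia.
by case: ha hb ea eb e => -> [] -> -> -> e; move: e; clear; lia.
Qed.

Lemma Ok_even_mul Y Z W : Ok Y -> Ok Z -> Ok W -> Y * Z = 2%:R * W ->
  (exists2 Y', Ok Y' & Y = 2%:R * Y') \/ (exists2 Z', Ok Z' & Z = 2%:R * Z').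
Proof.
move=> /OkP[a [b ->]] /OkP[c [d ->]] /OkP[u [v ->]] e.
have : (2 %| znorm a b * znorm c d)%Z.
  have : zom a b * zom c d = zom (2 * u) (2 * v) by rewrite e /zomega !intrM; ring.
  rewrite zomM => /zom_inj[h1 h2]; rewrite -znormM h1 h2; apply/dvdzP.
  by exists (2 * znorm u v); rewrite /zomega_norm; ring.
have half x y : (2 %| x)%Z -> (2 %| y)%Z -> exists2 Y', Ok Y' & zom x y = 2%:R * Y'.
  move=> /dvdzP[x' ->] /dvdzP[y' ->]; exists (zom x' y'); first exact: Ok_zom.
  by rewrite /zomega !intrM; ring.
rewrite (@Euclid_dvdzM 2) // => /orP[] /zom_even_of_norm[h1 h2]; [left|right]; exact: half.
Qed.

(** The norm of Z is an odd integer 2q + 1, so 1 is a multiple of Z minus 2q. *)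
Lemma Ok_coprime2 Z : Ok Z -> ~ (exists2 Z', Ok Z' & Z = 2%:R * Z') ->
  coprime_ideals Ok (principal Ok Z) (principal Ok 2).
Proof.
move=> OZ nZ; apply/seteqP; split=> [x [a [b [[a' Oa' ->] [b' Ob' ->] ->]]]|x Ox].
  by apply: intringD; apply: intringM => //; apply: (intring_int 2).
have [c [d eZ]] := OkP OZ.
have n2 : ~~ (2 %| znorm c d)%Z.
  apply/negP => /zom_even_of_norm[/dvdzP[c' ec] /dvdzP[d' ed]]; apply: nZ.
  by exists (zom c' d'); [apply: Ok_zom|rewrite eZ ec ed /zomega !intrM; ring].
pose q := (znorm c d %/ 2)%Z.
have eq1 : znorm c d = 2 * q + 1 by rewrite /q; move: n2; clear; lia.
have Oq : Ok (- q%:~R) by apply: intringN; apply: intring_int.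
have Oc : Ok (zom (c + d) (- d)) by apply: Ok_zom.
exists (x * zom (c + d) (- d) * Z), (x * (- q%:~R) * 2); split.
- by exists (x * zom (c + d) (- d)) => //; apply: intringM.
- by exists (x * (- q%:~R)) => //; apply: intringM.
have -> : x * zom (c + d) (- d) * Z = x * (zom c d * zom (c + d) (- d)) by rewrite eZ; ring.
by rewrite zom_conj eq1 intrD intrM; ring.
Qed.

(** * Consequences of class number one: gcds and a unit of norm -1 *)

Section ClassNumberOne.
Hypothesis k_class1 : class_number k 1.

(** I and O_k lie in the single class, represented by J: a I = b J and c O_k = d J. The element g of
    J with c = d g generates J, and e with a e = b g generates I. *)
Lemma ideal_principal I : nonzero_ideal Ok I -> exists2 d, I d & I = principal Ok d.
Proof.
move=> [idI [x0 Ix0 x00]]; have [C [_ _ HC]] := k_class1.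
have idO : nonzero_ideal Ok Ok.
  split; last by exists 1; [apply: intring1|apply: oner_neq0].
  by split=> // [|x y|a x]; [apply: intring0|apply: intringD|apply: intringM].
have [i [a [b [Oa Ob a0 b0 eI]]]] := HC _ (conj idI (ex_intro2 _ _ x0 Ix0 x00)).
have [j [c [d [Oc Od c0' d0 eO]]]] := HC _ idO.
rewrite (ord1 j) (ord1 i) in eI eO; set J := C ord0 in eI eO.
have Jd : exists2 g, J g & c * 1 = d * g.
  by have : [set c * x | x in Ok] (c * 1) by [exists 1 => //; apply: intring1|];
    rewrite eO => -[g Jg <-]; exists g.
case: Jd => g Jg; rewrite mulr1 => ecd.
have [e Ie eae] : exists2 e, I e & a * e = b * g.
  by have : [set b * x | x in J] (b * g) by [exists g|]; rewrite -eI => -[e Ie <-]; exists e.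
exists e => //; apply/seteqP; split=> [x Ix|x [y Oy ->]]; last by case: idI => _ _ _; apply.
have [h Jh eh] : exists2 h, J h & b * h = a * x.
  by have : [set a * x | x in I] (a * x) by [exists x|]; rewrite eI => -[h Jh <-]; exists h.
have [f Of ef] : exists2 f, Ok f & c * f = d * h.
  by have : [set d * x | x in J] (d * h) by [exists h|]; rewrite -eO => -[f Of <-]; exists f.
exists f => //; apply: (mulfI a0); rewrite -eh mulrCA eae; apply: (mulfI d0).
by rewrite mulrCA -ef ecd; ring.
Qed.

(** Coprimality of the quotients is given as a Bezout relation, which implies [gcd3_eq1] and
    persists under scaling by a unit. *)
Lemma bezout3 X Y Z : Ok X -> Ok Y -> Ok Z -> ~ [/\ X = 0, Y = 0 & Z = 0] ->
  exists d X1 Y1 Z1 a b c, [/\ Ok d, Ok X1, Ok Y1 & Ok Z1] /\ [/\ Ok a, Ok b & Ok c] /\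
   [/\ d != 0, X = X1 * d, Y = Y1 * d, Z = Z1 * d & a * X1 + b * Y1 + c * Z1 = 1].
Proof.
move=> OX OY OZ n0.
pose I : set algC := [set x | exists a b c, [/\ Ok a, Ok b, Ok c & x = a * X + b * Y + c * Z]].
have IX : I X by exists 1, 0, 0; split; [apply: intring1|apply: intring0|apply: intring0|ring].
have IY : I Y by exists 0, 1, 0; split; [apply: intring0|apply: intring1|apply: intring0|ring].
have IZ : I Z by exists 0, 0, 1; split; [apply: intring0|apply: intring0|apply: intring1|ring].
have nzI : nonzero_ideal Ok I.
  split.
    split.
    - by move=> x [a [b [c [Oa Ob Oc ->]]]]; apply: intringD; [apply: intringD|]; apply: intringM.
    - by exists 0, 0, 0; split; try (exact: intring0); ring.
    - move=> x y [a [b [c [Oa Ob Oc ->]]]] [a' [b' [c' [Oa' Ob' Oc' ->]]]].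
      by exists (a + a'), (b + b'), (c + c'); split; try (exact: intringD); ring.
    - move=> e x Oe [a [b [c [Oa Ob Oc ->]]]].
      by exists (e * a), (e * b), (e * c); split; try (exact: intringM); ring.
  have [X0|X0] := eqVneq X 0; last by exists X.
  have [Y0|Y0] := eqVneq Y 0; last by exists Y.
  have [Z0|Z0] := eqVneq Z 0; last by exists Z.
  by case: n0.
have [d Id eI] := ideal_principal nzI.
have [X1 OX1 eX] : principal Ok d X by rewrite -eI.
have [Y1 OY1 eY] : principal Ok d Y by rewrite -eI.
have [Z1 OZ1 eZ] : principal Ok d Z by rewrite -eI.
have [a [b [c [Oa Ob Oc ed]]]] := Id.
have Od : Ok d by case: nzI => -[IO _ _ _] _; apply: IO.
have d0 : d != 0.
  by apply/eqP => d0; apply: n0; split; rewrite ?eX ?eY ?eZ d0 mulr0.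
exists d, X1, Y1, Z1, a, b, c; split=> //; split=> //; split=> //.
by apply: (mulIf d0); rewrite mul1r [RHS]ed eX eY eZ; ring.
Qed.

(* Write p = s^2 + t^2 with t odd and g = s + sqrt p, so that g * conj g = - t^2 and (g, conj g, t)
   is the unit ideal. Then (g) = (g, t)^2 = (d)^2, and g / d^2 is a unit of norm -1. *)
Lemma unit_norm_N1 : exists e f, znorm e f = -1 /\ exists2 v, Ok v & zom e f * v = 1.
Proof.
have p4 : (p = 1 %[mod 4])%N by move: p_mod8; clear; lia.
have [s [t [est todd]]] : exists s t : int, p%:Z = s ^+ 2 + t ^+ 2 /\ ~~ (2 %| t)%Z.
  have [s [t e]] := sum_two_squares p_pr p4.
  have [t2|t2] := boolP (2 %| t)%Z; last by exists s, t.
  exists t, s; split; first by rewrite addrC.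
  apply/negP => s2; have : (2 %| p%:Z)%Z.
    by rewrite e !expr2 rpredD ?dvdz_mulr.
  by rewrite pE; clear; lia.
(* Since sqrt p = 2 omega - 1, these are s + sqrt p and s - sqrt p. *)
pose g0 := zom (s - 1) 2; pose g0' := zom (s + 1) (- 2).
have Og0 : Ok g0 by apply: Ok_zom.
have Og0' : Ok g0' by apply: Ok_zom.
have gg : g0 * g0' = - (t%:~R ^+ 2).
  rewrite /g0 /g0'; have -> : s + 1 = (s - 1) + 2 by ring.
  rewrite zom_conj -rmorphXn -mulrNz /=; congr (_%:~R); rewrite /zomega_norm.
  have -> : t ^+ 2 = p%:Z - s ^+ 2 by rewrite est; ring.
  by rewrite pE; ring.
have t0 : t%:~R != 0 :> algC by rewrite intr_eq0; apply: contraNneq todd => ->.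
have [|d [g [h [z [a [b [c [[Od Og Oh Oz] [[Oa Ob Oc] [d0 eg eh ez e1]]]]]]]]]] :=
    bezout3 Og0 (intring_int t) intring0.
  by case=> _ t0'; rewrite t0' eqxx in t0.
have {ez} z0 : z = 0 by move/eqP: ez; rewrite eq_sym mulf_eq0 (negbTE d0) orbF => /eqP.
(* A common prime factor of 2s and t would be odd and divide s and t, so its square would divide
   p. *)
have [i [j eij]] : exists i j : int, i * (2 * s) + j * t = 1.
  have [i [j eij]] := Bezoutz (2 * s) t; exists i, j; rewrite eij.
  congr Posz; apply/eqP; set G := gcdn _ _.
  have G0 : (0 < G)%N by rewrite gcdn_gt0 !absz_gt0 -(intr_eq0 algC t) t0 orbT.
  have [//|G1] := eqVneq G 1%N.
  have [l l_pr lG] : exists2 l, prime l & (l %| G)%N.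
    by exists (pdiv G); rewrite ?pdiv_dvd // pdiv_prime // ltn_neqAle eq_sym G1.
  move: lG; rewrite dvdn_gcd => /andP[ls lt].
  have {}ls : (l%:Z %| 2 * s)%Z by rewrite dvdzE.
  have {}lt : (l%:Z %| t)%Z by rewrite dvdzE.
  have l2 : ~~ (l%:Z %| 2)%Z.
    by rewrite dvdzE /= dvdn_prime2 //; apply/eqP => l2; move: lt; rewrite l2; apply/negP.
  move: ls; rewrite Euclid_dvdzM // (negbTE l2) /= => ls.
  have : (l%:Z * l%:Z %| p%:Z)%Z by rewrite est !expr2 rpredD ?dvdz_mul.
  rewrite dvdzE abszM /=; case/primeP: (p_pr) => p1 H /H/orP[]/eqP;
    first by move: (prime_gt1 l_pr); clear; nia.
  by move=> e; case: (@prime_not_square p) => //; exists l; rewrite -e -mulnn.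
have gg2 : g0 + g0' = (2 * s)%:~R by rewrite /g0 /g0' /zomega !intrD !mulrNz; ring.
rewrite z0 mulr0 addr0 in e1.
(* Two mutually inverse units. Squaring d = a g0 + b t and using t^2 = - g0 g0' gives d^2 = g0 mu.
   From g0 = g d and t = h d, d^2 ep = i (g0^2 - t^2) + j g0 t = g0 (i (g0 + g0') + j t) = g0,
   because g0 + g0' = 2s. *)
pose mu := a ^+ 2 * g0 + 2%:R * a * b * t%:~R - b ^+ 2 * g0'.
pose ep := i%:~R * (g ^+ 2 - h ^+ 2) + j%:~R * g * h.
have ed : d = a * g0 + b * t%:~R by rewrite eg eh -[LHS]mul1r -e1; ring.
have ed2 : d ^+ 2 = g0 * mu.
  rewrite ed; have -> : (a * g0 + b * t%:~R) ^+ 2 = a ^+ 2 * g0 ^+ 2 + 2%:R * a * b * g0 * t%:~R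
    - b ^+ 2 * - (t%:~R ^+ 2) by ring.
  by rewrite -gg /mu; ring.
have eep : d ^+ 2 * ep = g0.
  have -> : d ^+ 2 * ep = i%:~R * ((g * d) ^+ 2 + - ((h * d) ^+ 2)) + j%:~R * (g * d) * (h * d).
    by rewrite /ep; ring.
  rewrite -eg -eh -gg.
  have -> : i%:~R * (g0 ^+ 2 + g0 * g0') + j%:~R * g0 * t%:~R = g0 * (i%:~R * (g0 + g0')
    + j%:~R * t%:~R) by ring.
  by rewrite gg2 -!intrM -intrD eij mulr1.
have g00 : g0 != 0.
  by apply/eqP => g00; move/eqP: gg; rewrite g00 mul0r eq_sym oppr_eq0 sqrf_eq0 (negbTE t0).
have Oep : Ok ep.
  apply: intringD; last by apply: intringM => //; apply: intringM => //; apply: intring_int.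
  by apply: intringM; [apply: intring_int|apply: intringB; rewrite expr2; apply: intringM].
have Omu : Ok mu.
  apply: intringB; last by apply: intringM => //; rewrite expr2; apply: intringM.
  apply: intringD; first by apply: intringM => //; rewrite expr2; apply: intringM.
  by apply: intringM; [do 2 apply: intringM => //; exact: (intring_int 2)|exact: intring_int].
have emu : ep * mu = 1 by apply: (mulfI g00); rewrite mulr1 -[RHS]eep ed2; ring.
have [e [f eef]] := OkP Oep; have [m1 [m2 em]] := OkP Omu; have [d1 [d2 edd]] := OkP Od.
exists e, f; split; last by exists mu; rewrite -?eef.
have n1 : znorm e f * znorm m1 m2 = 1.
  have : zom 1 0 = zom e f * zom m1 m2 by rewrite -eef -em emu /zomega mul0r addr0.
  by rewrite zomM => /zom_inj[h1 h2]; rewrite -znormM -h1 -h2 /zomega_norm; ring.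
(* Norms in g0 = d^2 ep: the left side is negative, which excludes norm 1 for ep. *)
have n2 : - t ^+ 2 = znorm d1 d2 ^+ 2 * znorm e f.
  have : zom (s - 1) 2 = zom d1 d2 * zom d1 d2 * zom e f by rewrite -edd -eef -expr2 eep.
  rewrite !zomM => /zom_inj[h1 h2].
  have -> : - t ^+ 2 = znorm (s - 1) 2.
    have -> : t ^+ 2 = p%:Z - s ^+ 2 by rewrite est; ring.
    by rewrite /zomega_norm pE; ring.
  by rewrite h1 h2 !znormM expr2.
have t0' : t != 0 by rewrite -(intr_eq0 algC).
have t2 : 0 < t ^+ 2 by rewrite lt_neqAle eq_sym sqrf_eq0 t0' sqr_ge0.
have d2' : 0 <= znorm d1 d2 ^+ 2 by apply: sqr_ge0.
have [nu|nu] : znorm e f = 1 \/ znorm e f = -1.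
  move: (congr1 absz n1); rewrite abszM => /eqP; rewrite -[absz 1]/1%N muln_eq1 => /andP[/eqP nu _].
  by move: nu; move: (znorm e f); clear; lia.
- by exfalso; move: n2 t2 d2'; rewrite nu mulr1; move: (t ^+ 2) (_ ^+ 2); clear; lia.
- exact: nu.
Qed.

Lemma unit_mul_square_mod4 x : Ok x -> ~ (exists2 x', Ok x' & x = 2%:R * x') ->
  exists u u' l m, [/\ Ok u, Ok u', Ok l & Ok m] /\ u * u' = 1 /\ l ^+ 2 - u * x = m * 4%:R.
Proof.
move=> /OkP[a [b ->]] nx; have [e [f [nef [v Ov ev]]]] := unit_norm_N1.
have ab : ~~ ((2 %| a)%Z && (2 %| b)%Z).
  apply/negP => /andP[/dvdzP[a' ea] /dvdzP[b' eb]]; apply: nx; exists (zom a' b').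
    exact: Ok_zom.
  by rewrite ea eb /zomega !intrM; ring.
have c2 : ~~ (2 %| c0)%Z by have [c ->] := c0_odd; clear; lia.
have [u1 [u2 [l1 [l2 [hu [/dvdzP[q1 h1] /dvdzP[q2 h2]]]]]]] := unit_square_mod4 c2 ab nef.
have [u' Ou' eu] : exists2 u', Ok u' & zom u1 u2 * u' = 1.
  move: hu; rewrite !inE => /or4P[]/eqP[-> ->].
  - by exists 1; [apply: intring1|rewrite /zomega; ring].
  - by exists (-1); [apply: intringN; apply: intring1|rewrite /zomega; ring].
  - by exists v.
  - exists (- v); first exact: intringN.
    by rewrite -ev /zomega !mulrNz; ring.
exists (zom u1 u2), u', (zom l1 l2), (zom q1 q2); split; first by split=> //; apply: Ok_zom.
split=> //; rewrite expr2 !zomM.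
have -> : zom q1 q2 * 4%:R = zom (q1 * 4) (q2 * 4) by rewrite /zomega !intrM; ring.
rewrite -h1 -h2 /sqr_sub_mul1 /sqr_sub_mul2 /zomega.
by rewrite !(intrB, intrD, rmorphXn, intrM) /=; ring.
Qed.
End ClassNumberOne.
End QuadraticIntegers.

(** * Redei symbols *)

(** [splits_completely] speaks of all primes above r and yields nothing until one is produced.
    Zorn's lemma gives an ideal maximal among the proper ones containing r, and such an ideal is
    prime. *)
Lemma prime_over_exists (s : seq algC) (r : nat) : prime r ->
  exists P, prime_over (integers_of (Qadjoin s)) P r.
Proof.
move=> r_pr; set O := integers_of _.
have O0 : O 0 := intring0; have O1 : O 1 := intring1.
have OD x y : O x -> O y -> O (x + y) by apply: intringD.
have OM x y : O x -> O y -> O (x * y) by apply: intringM.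
have Oint n : O n%:~R by apply: intring_int.
pose proper I := [/\ is_ideal O I, I r%:R & ~ I 1].
have proper_r : proper (principal O r%:R).
  split; last 1 first.
  - case=> c [_ cA] e.
    have r0 : r%:R != 0 :> algC by rewrite pnatr_eq0 -lt0n prime_gt0.
    have ec : c = ratr (r%:R^-1) by rewrite fmorphV /= ratr_nat; apply: (mulIf r0);
      rewrite -e mulVf.
    have /intrP[n en] : c \is a Num.int by apply: Cint_rat_Aint => //; rewrite ec Crat_rat.
    have : (n * r%:Z)%:~R = 1%:~R :> algC by rewrite intrM -en -pmulrn -e.
    move/intr_inj => h; have : (r%:Z %| 1)%Z by apply/dvdzP; exists n.
    by rewrite dvdzE /= dvdn1 => /eqP r1; move: r_pr; rewrite r1.
  - split.
    + by move=> x [c Oc ->]; apply: OM => //; apply: (Oint r%:Z).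
    + by exists 0; rewrite ?mul0r.
    + by move=> x y [c Oc ->] [d Od ->]; exists (c + d); [apply: OD|ring].
    + by move=> a x Oa [c Oc ->]; exists (a * c); [apply: OM|ring].
  - by exists 1; rewrite ?mul1r.
pose P I := I = set0 \/ proper I.
have [|A [PA maxA]] := @Zorn_bigcup algC P.
  move=> F FP totF.
  have [[I0 FI0 [idI0 I0r _]]|nF] := pselect (exists2 I, F I & proper I); last first.
    left; apply/seteqP; split=> // x [I FI Ix].
    have [I0|pI] := FP _ FI; first by rewrite I0 in Ix.
    by apply: nF; exists I.
  have memP I x : F I -> I x -> proper I.
    by move=> FI Ix; have [I0'|//] := FP _ FI; rewrite I0' in Ix.
  right; split; last 1 first.
  - by case=> I FI I1; case: (memP _ _ FI I1).
  - split.
    + by move=> x [I FI Ix]; have [[IO _ _ _] _ _] := memP _ _ FI Ix; apply: IO.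
    + by exists I0 => //; case: idI0.
    + move=> x y [I FI Ix] [J FJ Jy].
      have [[_ _ DI _] _ _] := memP _ _ FI Ix; have [[_ _ DJ _] _ _] := memP _ _ FJ Jy.
      have [IJ|JI] := totF _ _ FI FJ; first by exists J => //; apply: DJ => //; apply: IJ.
      by exists I => //; apply: DI => //; apply: JI.
    + move=> a x Oa [I FI Ix]; exists I => //.
      by have [[_ _ _ MI] _ _] := memP _ _ FI Ix; apply: MI.
  - by exists I0.
have pA : proper A.
  case: PA => // A0; case: (maxA (principal O r%:R)); last by right.
  rewrite A0; split=> // h; have [_ hr _] := proper_r.
  exact: (h _ hr).
have [idA Ar A1] := pA; have [AO A0 AD AM] := idA.
have Aint_dvd (n : int) : (r%:Z %| n)%Z -> A n%:~R.
  by case/dvdzP=> q ->; rewrite intrM; apply: AM => //; apply: Oint.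
exists A; split; last first.
  move=> n; split; last exact: Aint_dvd.
  move=> An; apply/negPn/negP => rn; apply: A1.
  have [b rb] := inverse_mod_prime r_pr rn.
  have -> : 1 = b%:~R * n%:~R + (-1) * (n * b - 1)%:~R :> algC by rewrite intrB intrM; ring.
  by apply: AD; apply: AM => //; [exact: (Oint (-1))|exact: Aint_dvd].
split=> // a b Oa Ob Aab; have [Aa|nAa] := pselect (A a); [by left|right].
pose B : set algC := [set x | exists y c, [/\ A y, O c & x = y + c * a]].
have AB : A `<=` B by move=> x Ax; exists x, 0; split=> //; ring.
have Ba : B a by exists 0, 1; split=> //; ring.
have B1 : B 1.
  have [//|nB1] := pselect (B 1); exfalso; apply: (maxA B).
    by split=> // BA; apply: nAa; apply: BA.
  right; split=> //; last exact: AB.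
  split.
  - by move=> x [y [c [Ay Oc ->]]]; apply: OD; [apply: AO|apply: OM].
  - exact: AB.
  - move=> x x' [y [c [Ay Oc ->]]] [y' [c' [Ay' Oc' ->]]].
    by exists (y + y'), (c + c'); split; [apply: AD|apply: OD|ring].
  - move=> d x Od [y [c [Ay Oc ->]]].
    by exists (d * y), (d * c); split; [apply: AM|apply: OM|ring].
case: B1 => y [c [Ay Oc e1]].
have -> : b = b * y + c * (a * b) by rewrite -[LHS]mul1r e1; ring.
by apply: AD; apply: AM.
Qed.

(** Residue degree one provides a one-element basis b0 of the residue field, not necessarily 1.
    Since 1 = d1 b0 modulo P, b0 is congruent to an inverse of d1 mod r, hence every element to an
    integer. *)
Lemma splits_residue_int (s : seq algC) (r : nat) : prime r ->
  splits_completely r (Qadjoin s) ->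
  exists P, prime_over (integers_of (Qadjoin s)) P r /\
    forall x, integers_of (Qadjoin s) x -> exists c : int, P (x - c%:~R).
Proof.
move=> r_pr spl; have [P PP] := prime_over_exists s r_pr; exists P; split=> //.
set O := integers_of _ in spl PP *.
have [_ [b [Ob gen _]]] := spl _ PP.
have [[[PO P0 PD PM] P1 _] Pint] := PP.
have O1 : O 1 := intring1.
have Oint n : O n%:~R by apply: intring_int.
have PN x : P x -> P (- x) by move=> Px; rewrite -mulN1r; apply: PM => //; apply: (Oint (-1)).
have [c1] := gen 1 O1; rewrite big_ord_recl big_ord0 addr0.
set b0 := b ord0; move: (c1 ord0) => d1 h1.
have Ob0 : O b0 by apply: Ob.
have rd : ~~ (r%:Z %| d1)%Z.
  apply/negP => /Pint Pd; apply: P1.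
  have -> : 1 = (1 - d1%:~R * b0) + b0 * d1%:~R by ring.
  by apply: PD => //; apply: PM.
have [e re] := inverse_mod_prime r_pr rd.
have Pbe : P (b0 - e%:~R).
  have -> : b0 - e%:~R = b0 * - (d1 * e - 1)%:~R + (- e%:~R) * (1 - d1%:~R * b0).
    by rewrite intrB intrM; ring.
  apply: PD; apply: PM => //; first by apply: PN; apply/Pint.
  by rewrite -mulrNz; apply: Oint.
move=> x Ox; have [c] := gen x Ox; rewrite big_ord_recl big_ord0 addr0 -/b0.
move: (c ord0) => d h; exists (d * e).
have -> : x - (d * e)%:~R = (x - d%:~R * b0) + d%:~R * (b0 - e%:~R) by rewrite intrM; ring.
by apply: PD => //; apply: PM.
Qed.

Lemma odd_logn_two_primes (p q n : nat) : prime p -> prime q -> (0 < n)%N ->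
  (forall l, prime l -> odd (logn l n) -> l = p \/ l = q) ->
  exists i j t : nat, n = (p ^ i * q ^ j * t ^ 2)%N.
Proof.
move=> p_pr q_pr; elim/ltn_ind: n => n IH n0 hn.
have [n1|n1] := leqP n 1.
  by exists 0%N, 0%N, 1%N; move: n0 n1; clear; lia.
have [l l_pr /dvdnP[m em]] : exists2 l, prime l & (l %| n)%N.
  by exists (pdiv n); [apply: pdiv_prime|apply: pdiv_dvd].
have l1 := prime_gt1 l_pr; have l0 := prime_gt0 l_pr.
have m0 : (0 < m)%N by move: n0; rewrite em muln_gt0 => /andP[].
have [/dvdnP[m' em']|lm] := boolP (l %| m)%N.
  have e : n = (m' * l ^ 2)%N by rewrite em em' -mulnA mulnn.
  have m'0 : (0 < m')%N by move: n0; rewrite e muln_gt0 => /andP[].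
  have l20 : (0 < l ^ 2)%N by rewrite expn_gt0 l0.
  have [||i [j [t et]]] := IH m' _ m'0.
  - by rewrite e ltn_Pmulr // -(exp1n 2) ltn_exp2r.
  - move=> l' l'_pr ol; apply: hn => //.
    by rewrite e (lognM l' m'0 l20) (lognX l' l 2) oddD oddM /= addbF.
  by exists i, j, (t * l)%N; rewrite e et expnMn mulnA.
have logl : logn l n = 1%N.
  by rewrite em (lognM _ m0 l0) (logn_prime _ l_pr) eqxx lognE l_pr m0 (negbTE lm).
have [||i [j [t et]]] := IH m _ m0.
- by rewrite em ltn_Pmulr.
- move=> l' l'_pr ol; apply: hn => //.
  have ll : l' != l by apply: contraTneq ol => ->; rewrite lognE l_pr m0 (negbTE lm).
  by rewrite em (lognM _ m0 l0) (logn_prime _ l_pr) (negbTE ll) addn0.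
have [e|e] : l = p \/ l = q by apply: hn; rewrite ?logl.
- by exists i.+1, j, t; rewrite em et e (expnS p i); ring.
- by exists i, j.+1, t; rewrite em et e (expnS q j); ring.
Qed.

(** * Independence of the Rédei field of the chosen solution *)

Section Independence.
Variables (p1 p2 : nat) (x y z x' y' z' : int).
Hypotheses (pr1 : prime p1) (pr2 : prime p2).
Hypotheses (m1 : (p1 = 1 %[mod 4])%N) (m2 : (p2 = 1 %[mod 4])%N).
Hypotheses (sol : redei_solution p1 p2 x y z) (sol' : redei_solution p1 p2 x' y' z').
Hypothesis z_p2 : forall l, prime l -> (l%:Z %| z)%Z -> l = p2.
Hypothesis s1 : (4 %| p2%:Z * z * z' - 1)%Z.

(** A square root of the norm of alpha alpha', normalised to 1 mod 4 through the free sign of z';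
    [S] is half of Tr(alpha alpha') + 2s. *)
Let s := p2%:Z * z * z'.
Let S := x * x' + p1%:Z * y * y' + s.

Let exyz : p2%:Z * z ^+ 2 = x ^+ 2 - p1%:Z * y ^+ 2.
Proof. by case: sol => e _ _ _; move: e; clear; lia. Qed.
Let exyz' : p2%:Z * z' ^+ 2 = x' ^+ 2 - p1%:Z * y' ^+ 2.
Proof. by case: sol' => e _ _ _; move: e; clear; lia. Qed.

Lemma redei_solution_half (a b c : int) : redei_solution p1 p2 a b c ->
  exists h A C : int, [/\ b = 2 * h, a ^+ 2 = 8 * A + 1, c ^+ 2 = 8 * C + 1 & ~~ (2 %| c)%Z].
Proof.
case=> e _ /dvdzP[h eh] ab.
have odd_sqr (i : int) : ~~ (2 %| i)%Z -> exists I : int, i ^+ 2 = 8 * I + 1.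
  move=> i2; have [j ej] : exists j : int, i = 2 * j + 1 by exists (i %/ 2)%Z; move: i2; clear; lia.
  have : (2 %| j * (j + 1))%Z by rewrite (@Euclid_dvdzM 2) //; clear; lia.
  case/dvdzP=> J eJ; exists J; rewrite ej.
  have -> : (2 * j + 1) ^+ 2 = 4 * (j * (j + 1)) + 1 by ring.
  by rewrite eJ; ring.
have a2 : ~~ (2 %| a)%Z by move: ab; rewrite eh; clear; lia.
have [A eA] := odd_sqr _ a2.
have c2 : ~~ (2 %| c)%Z.
  apply/negP => /dvdzP[d ed]; move: e; rewrite eA eh ed; clear.
  have -> : 8 * A + 1 - p1%:Z * (h * 2) ^+ 2 - p2%:Z * (d * 2) ^+ 2
    = 2 * (4 * A - 2 * p1%:Z * h ^+ 2 - 2 * p2%:Z * d ^+ 2) + 1 by ring.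
  by move: (4 * A - _ - _); clear; lia.
have [C eC] := odd_sqr _ c2.
by exists h, A, C; split=> //; rewrite eh mulrC.
Qed.

(** With y = 2h the equation reads p2 = 1 - 4 h^2 modulo 8, so the parity of h depends on p2 alone
    and is the same for both solutions. *)
Let y4 : (4 %| y + y')%Z.
Proof.
have [h [A [C [eh eA eC _]]]] := redei_solution_half sol.
have [h' [A' [C' [eh' eA' eC' _]]]] := redei_solution_half sol'.
have [q eq1] : exists q : int, p1%:Z = 2 * q + 1 by exists (p1 %/ 2)%N%:Z; move: m1; clear; lia.
have : (2 %| (h - h') * (h + h'))%Z.
  apply/dvdzP; exists (A - A' - p2%:Z * (C - C') - q * (h ^+ 2 - h' ^+ 2)).
  move: exyz exyz'; rewrite eA eA' eC eC' eh eh' eq1 => e e'.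
  have e4 : 4 * ((h - h') * (h + h')) =
     4 * ((A - A' - p2%:Z * (C - C') - q * (h ^+ 2 - h' ^+ 2)) * 2).
    have E : p2%:Z * (8 * C + 1) - p2%:Z * (8 * C' + 1) = 8 * A + 1 - (2 * q + 1) * (2 * h) ^+ 2
       - (8 * A' + 1 - (2 * q + 1) * (2 * h') ^+ 2) by rewrite e e'.
    apply/eqP; rewrite -subr_eq0; move/eqP: E; rewrite -subr_eq0 => /eqP E.
    by apply/eqP; rewrite -[RHS]E; ring.
  by apply: (mulfI _ e4).
rewrite (@Euclid_dvdzM 2) // eh eh'; move=> /orP[] /dvdzP[t et]; apply/dvdzP.
  by exists (t + h'); move: et; clear; lia.
by exists t; move: et; clear; lia.
Qed.

Let yy4 : (4 %| y * y')%Z.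
Proof.
case: sol sol' => _ _ y2 _ [_ _ y2' _]; case/dvdzP: y2 => a ->; case/dvdzP: y2' => b ->.
by apply/dvdzP; exists (a * b); ring.
Qed.

Let x4 : (4 %| x - y - 1)%Z.
Proof. by case: sol => _ _ _; clear; lia. Qed.
Let x4' : (4 %| x' - y' - 1)%Z.
Proof. by case: sol' => _ _ _; clear; lia. Qed.

Let S4 : (4 %| S - 2)%Z.
Proof.
have -> : S - 2 = (x - y - 1) * x' + (x' - y' - 1) * (1 + y) + (y + y')
  + (y * y') * (1 + p1%:Z) + (s - 1) by rewrite /S; ring.
apply: rpredD; last exact: s1.
apply: rpredD; last exact: dvdz_mulr.
apply: rpredD; last exact: y4.
by apply: rpredD; apply: dvdz_mulr.
Qed.

Let T4 : (4 %| x * y' + x' * y)%Z.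
Proof.
have -> : x * y' + x' * y = (x - y - 1) * y' + (x' - y' - 1) * y + (y + y') + (y * y') * 2 by ring.
apply: rpredD; last exact: dvdz_mulr.
apply: rpredD; last exact: y4.
by apply: rpredD; apply: dvdz_mulr.
Qed.

(* Here m is (Tr(alpha alpha') + 2s) / 4 with s^2 = N(alpha alpha'), so that
   alpha alpha' m = ((alpha alpha' + s) / 2)^2. *)
Lemma redei_product_multiplier : exists m T : int,
  [/\ S = 2 * m, x * y' + x' * y = 4 * T, m * (m - s) = 4 * p1%:Z * T ^+ 2 & (4 %| m - 1)%Z].
Proof.
have /dvdzP[K eK] := S4; have /dvdzP[T eT] := T4.
have eT' : x * y' + x' * y = 4 * T by rewrite eT mulrC.
(* S - s and x y' + x' y are the coordinates of alpha alpha', whose norm is s^2. *)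
have SD : S * (S - 2 * s) = p1%:Z * (x * y' + x' * y) ^+ 2.
  have -> : S * (S - 2 * s) = (x * x' + p1%:Z * y * y') ^+ 2 - (p2%:Z * z ^+ 2) * (p2%:Z * z' ^+ 2).
    by rewrite /S /s; ring.
  by rewrite exyz exyz'; ring.
exists (2 * K + 1), T.
have eS : S = 2 * (2 * K + 1) by move: eK; clear; move: (S) => S0; lia.
have em : (2 * K + 1) * (2 * K + 1 - s) = 4 * p1%:Z * T ^+ 2.
  have e4 : 4 * ((2 * K + 1) * (2 * K + 1 - s)) = 4 * (4 * p1%:Z * T ^+ 2).
    by move: SD; rewrite eT' eS => SD;
      transitivity (2 * (2 * K + 1) * (2 * (2 * K + 1) - 2 * s)); [ring|rewrite SD; ring].
  by apply: (mulfI _ e4).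
split=> //.
(* The multiplier 2K + 1 is odd, so 4 divides its difference with s, and s = 1 mod 4. *)
have : (4 %| (2 * K + 1) * (2 * K + 1 - s))%Z by rewrite em -mulrA dvdz_mulr.
case/dvdzP=> Q eQ.
have -> : 2 * K + 1 - 1 = (2 * K + 1 - s) + (s - 1) by ring.
apply: rpredD; last exact: s1.
apply/dvdzP; exists (Q * (2 * K + 1) - (K ^+ 2 + K) * (2 * K + 1 - s)).
have -> : (Q * (2 * K + 1) - (K ^+ 2 + K) * (2 * K + 1 - s)) * 4 =
  (Q * 4) * (2 * K + 1) - 4 * (K ^+ 2 + K) * (2 * K + 1 - s) by ring.
by rewrite -eQ; ring.
Qed.

(** For another prime l of odd exponent in m, the equation m (m - s) = 4 p1 T^2 forces l to divide m
    - s, hence s, z' and T. Then l divides alpha alpha'; multiplying by the conjugate of alpha, with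
    p2 z^2 prime to l, shows that l divides alpha', against primitivity. *)
Lemma redei_product_multiplier_primes (m T : int) : m != 0 -> ~~ (2 %| m)%Z -> S = 2 * m ->
  x * y' + x' * y = 4 * T -> m * (m - s) = 4 * p1%:Z * T ^+ 2 ->
  forall l, prime l -> odd (logn l `|m|) -> l = p1 \/ l = p2.
Proof.
move=> m0 m_odd eS eT em l l_pr ol.
have lm : (l%:Z %| m)%Z by apply: contraTT ol => /logn_ndvdz ->.
have [->|l1] := eqVneq l p1; first by left.
have [->|l2] := eqVneq l p2; [by right|exfalso].
have ltwo : ~~ (l%:Z %| 2)%Z.
  by rewrite dvdzE /= dvdn_prime2 //; apply/eqP => e; move: lm; rewrite e; apply/negP.
have lp1 : ~~ (l%:Z %| p1%:Z)%Z by rewrite prime_dvdzN.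
have lp2 : ~~ (l%:Z %| p2%:Z)%Z by rewrite prime_dvdzN.
have lz : ~~ (l%:Z %| z)%Z by apply: contra l2 => /(z_p2 l_pr) ->.
have l4 : ~~ (l%:Z %| 4 * p1%:Z)%Z.
  by have -> : 4 * p1%:Z = 2 * (2 * p1%:Z) by [ring|];
    rewrite !Euclid_dvdzM // (negbTE ltwo) (negbTE lp1).
have [lms|lms] := boolP (l%:Z %| m - s)%Z; last first.
  have ms0 : m - s != 0 by apply: contraNneq lms => ->; rewrite dvdz0.
  have T0 : T != 0.
    apply: contraTneq (mulf_neq0 m0 ms0) => T0.
    by rewrite em T0 expr0n /= mulr0 eqxx.
  move: (congr1 (fun i : int => odd (logn l `|i|)) em); rewrite !expr2 !abszM.
  have g1 : (0 < `|m|)%N by rewrite absz_gt0.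
  have g2 : (0 < `|m - s|)%N by rewrite absz_gt0.
  have g3 : (0 < `|T|)%N by rewrite absz_gt0.
  have g4 : (0 < `|T| * `|T|)%N by rewrite muln_gt0 g3.
  have g5 : (0 < `|4%Z| * `|p1|)%N by rewrite muln_gt0 /= prime_gt0.
  rewrite (lognM _ g1 g2) (lognM _ g5 g4) (lognM _ g3 g3) -abszM.
  rewrite (logn_ndvdz lms) (logn_ndvdz l4) addn0 add0n ol addnn odd_double //.
have ls : (l%:Z %| s)%Z.
  by have -> : s = m - (m - s) by [ring|]; rewrite rpredB.
have lz' : (l%:Z %| z')%Z.
  by move: ls; rewrite /s !Euclid_dvdzM // (negbTE lp2) (negbTE lz).
have lT : (l%:Z %| T)%Z.
  have : (l%:Z %| 4 * p1%:Z * T ^+ 2)%Z by rewrite -em dvdz_mulr.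
  by rewrite Euclid_dvdzM // (negbTE l4) /= Euclid_dvdzX2.
have lU : (l%:Z %| x * y' + x' * y)%Z by rewrite eT dvdz_mull.
have lV : (l%:Z %| x * x' + p1%:Z * y * y')%Z.
  have -> : x * x' + p1%:Z * y * y' = 2 * m - s by rewrite -eS /S; ring.
  by rewrite rpredB // dvdz_mull.
have lpz : (l%:Z %| p2%:Z * z ^+ 2)%Z = false.
  by rewrite Euclid_dvdzM // Euclid_dvdzX2 // (negbTE lp2) (negbTE lz).
have ly' : (l%:Z %| y')%Z.
  have : (l%:Z %| y' * (p2%:Z * z ^+ 2))%Z.
    have -> : y' * (p2%:Z * z ^+ 2) = x * (x * y' + x' * y) - y * (x * x' + p1%:Z * y * y').
      by rewrite exyz; ring.
    by rewrite rpredB // dvdz_mull.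
  by rewrite Euclid_dvdzM // lpz orbF.
have lx' : (l%:Z %| x')%Z.
  have : (l%:Z %| x' * (p2%:Z * z ^+ 2))%Z.
    have -> : x' * (p2%:Z * z ^+ 2) = x * (x * x' + p1%:Z * y * y') - p1%:Z * y * (x * y' + x' * y).
      by rewrite exyz; ring.
    by rewrite rpredB // dvdz_mull.
  by rewrite Euclid_dvdzM // lpz orbF.
by case: sol' => _ g _ _; apply: (prime_dvd_gcd3 l_pr g lx' ly' lz').
Qed.

(** The absolute value of m is a product of powers of p1 and p2 and an odd square, hence 1 mod 4; as
    m is also 1 mod 4, it is positive. *)
Lemma redei_product_multiplier_decomp (m T : int) : (4 %| m - 1)%Z -> S = 2 * m ->
  x * y' + x' * y = 4 * T -> m * (m - s) = 4 * p1%:Z * T ^+ 2 ->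
  exists i j t : nat, m = (p1 ^ i * p2 ^ j * t ^ 2)%N.
Proof.
move=> m4 eS eT em.
have m_odd : ~~ (2 %| m)%Z by move: m4; clear; lia.
have m0 : m != 0 by apply: contraNneq m_odd => ->.
have m0' : (0 < `|m|)%N by rewrite absz_gt0.
have [i [j [t et]]] := odd_logn_two_primes pr1 pr2 m0'
  (redei_product_multiplier_primes m0 m_odd eS eT em).
exists i, j, t.
have e4 : (`|m| = t ^ 2 %[mod 4])%N.
  have pi : (p1 ^ i = 1 %[mod 4])%N by rewrite -modnXm m1 modnXm exp1n.
  have pj : (p2 ^ j = 1 %[mod 4])%N by rewrite -modnXm m2 modnXm exp1n.
  rewrite et -modnMml; have -> : ((p1 ^ i * p2 ^ j) %% 4 = 1)%N by rewrite -modnMm pi pj.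
  by rewrite mul1n.
have t_odd : odd t.
  have : odd `|m| by move: m_odd; clear; lia.
  by rewrite et oddM oddX => /andP[].
have t4 : (t ^ 2 = 1 %[mod 4])%N.
  have -> : t = (t./2).*2.+1 by move: t_odd; clear; lia.
  by move: (t./2)%N; clear => h;
    have -> : (h.*2.+1 ^ 2 = (h ^ 2 + h) * 4 + 1)%N by [rewrite -muln2; ring|]; rewrite modnMDl.
by rewrite -et; move: e4 m4; rewrite t4; clear; lia.
Qed.

(** The field contains a square root q of m, because it contains those of p1 and p2. From alpha
    alpha' m = w^2 it follows that sqrt alpha sqrt alpha' q is w or -w. *)
Lemma sqrt_alpha_redei_field :
  redei_field p1 p2 x' y' (sqrtC (redei_alpha p1 x y)).
Proof.
have [m [T [eS eT em m4]]] := redei_product_multiplier.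
have [i [j [t et]]] := redei_product_multiplier_decomp m4 eS eT em.
rewrite /redei_field; set K := Qadjoin _.
set al := redei_alpha p1 x y; set al' := redei_alpha p1 x' y'.
set r1 : algC := sqrtC p1%:R; set r2 : algC := sqrtC p2%:R.
have Kr1 : K r1 by apply: Qadjoin_gen; rewrite !inE eqxx.
have Kr2 : K r2 by apply: Qadjoin_gen; rewrite !inE eqxx orbT.
have Kal' : K (sqrtC al') by apply: Qadjoin_gen; rewrite !inE eqxx !orbT.
have Kalpha (a b : int) : K (redei_alpha p1 a b).
  by apply: QadjoinD; [|apply: QadjoinM => //]; apply: Qadjoin_int.
(* For A = alpha alpha' the characteristic equation A^2 + s^2 = Tr(A) A gives (A + s)^2 = A (Tr(A) +
   2s) = 4 A m. *)
pose w := (al * al' + s%:~R) / 2%:R.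
have Kw : K w.
  apply: Qadjoin_div; last exact: Qadjoin_nat.
  by apply: QadjoinD; [apply: QadjoinM; apply: Kalpha|apply: Qadjoin_int].
pose q := r1 ^+ i * r2 ^+ j * t%:R.
have Kq : K q.
  by apply: QadjoinM; [apply: QadjoinM; apply: QadjoinX|apply: Qadjoin_nat].
have q2 : q ^+ 2 = m%:~R.
  rewrite et -pmulrn !natrM !natrX /q !exprMn -!exprM ![(_ * 2)%N]mulnC !exprM.
  by rewrite /r1 /r2 !sqrtCK.
have r12 : r1 ^+ 2 = p1%:R by apply: sqrtCK.
have w2 : w ^+ 2 = al * al' * m%:~R.
  have e1 : p2%:R * z%:~R ^+ 2 = x%:~R ^+ 2 - r1 ^+ 2 * y%:~R ^+ 2 :> algC.
    by rewrite r12 !pmulrn !expr2 -!intrM -intrB -!expr2 exyz.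
  have e2 : p2%:R * z'%:~R ^+ 2 = x'%:~R ^+ 2 - r1 ^+ 2 * y'%:~R ^+ 2 :> algC.
    by rewrite r12 !pmulrn !expr2 -!intrM -intrB -!expr2 exyz'.
  have e3 : 2%:R * m%:~R = x%:~R * x'%:~R + r1 ^+ 2 * y%:~R * y'%:~R + s%:~R :> algC.
    by rewrite r12 !pmulrn -!intrM -!intrD -eS.
  have e4 : s%:~R ^+ 2 = (x%:~R ^+ 2 - r1 ^+ 2 * y%:~R ^+ 2)
    * (x'%:~R ^+ 2 - r1 ^+ 2 * y'%:~R ^+ 2) :> algC.
    by rewrite -e1 -e2 /s !intrM -pmulrn; ring.
  apply: (mulfI (_ : 4%:R != 0)); first by rewrite pnatr_eq0.
  transitivity ((al * al' + s%:~R) ^+ 2); first by rewrite /w; field.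
  transitivity (2%:R * al * al' * (2%:R * m%:~R)); last by ring.
  have -> : (al * al' + s%:~R) ^+ 2 = al ^+ 2 * al' ^+ 2 + 2%:R * al * al' * s%:~R + s%:~R ^+ 2
    by ring.
  by rewrite e3 e4 /al /al' /redei_alpha -/r1; ring.
have z'0 : z' != 0 by apply: contraTneq s1 => ->; rewrite mulr0.
have al'0 : al' != 0.
  apply/eqP => h; have : p2%:R * z'%:~R ^+ 2 = al' * (x'%:~R - y'%:~R * r1) :> algC.
    transitivity (x'%:~R ^+ 2 - r1 ^+ 2 * y'%:~R ^+ 2 : algC).
      by rewrite r12 !pmulrn !expr2 -!intrM -intrB -!expr2 exyz'.
    by rewrite /al' /redei_alpha -/r1; ring.
  rewrite h mul0r => /eqP; rewrite mulf_eq0 pnatr_eq0 sqrf_eq0 intr_eq0 (negbTE z'0) orbF.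
  by move=> /eqP p20; move: pr2; rewrite p20.
have m0 : m%:~R != 0 :> algC.
  by rewrite intr_eq0; apply: contraTneq m4 => ->.
have q0 : q != 0 by rewrite -sqrf_eq0 q2.
have ra0 : sqrtC al' != 0 by rewrite sqrtC_eq0.
have : (sqrtC al * sqrtC al' * q) ^+ 2 == w ^+ 2
  by rewrite w2 exprMn [(sqrtC al * _) ^+ 2]exprMn !sqrtCK q2.
rewrite eqf_sqr => h.
have eq1 v : sqrtC al * sqrtC al' * q = v -> sqrtC al = v / (sqrtC al' * q).
  by move=> <-; field; rewrite q0 ra0.
have Kd : K (sqrtC al' * q) by apply: QadjoinM.
case/orP: h => /eqP/eq1 ->; apply: Qadjoin_div => //.
exact: QadjoinN.
Qed.
End Independence.

(** e and c are the residues of sqrt p1 and sqrt alpha modulo a prime above r of degree one, in the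
    field of whichever solution the symbol supplies. *)
Lemma redei_symbol_residues (p1 p2 r : nat) (x y z : int) : prime p1 -> prime p2 -> prime r ->
  (p1 = 1 %[mod 4])%N -> (p2 = 1 %[mod 4])%N -> redei_solution p1 p2 x y z ->
  (forall l, prime l -> (l%:Z %| z)%Z -> l = p2) -> redei_symbol p1 p2 r = 1 ->
  exists e c : int, (r%:Z %| e ^+ 2 - p1%:Z)%Z /\ (r%:Z %| x + y * e - c ^+ 2)%Z.
Proof.
move=> pr1 pr2 r_pr m1 m2 sol z_p2; rewrite /redei_symbol.
case: asboolP => // -[x' [y' [z' [sol' spl]]]] _.
have rf : redei_field p1 p2 x' y' (sqrtC (redei_alpha p1 x y)).
  have [_ [_ [_ [_ _ _ z2]]]] := redei_solution_half sol.
  have [_ [_ [_ [_ _ _ z2']]]] := redei_solution_half sol'.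
  (* Both z and z' are odd, so one sign of z' gives p2 z z' = 1 mod 4; changing that sign keeps a
     solution and its field. *)
  have [h|h] : (4 %| p2%:Z * z * z' - 1)%Z \/ (4 %| p2%:Z * z * - z' - 1)%Z.
    have zz : ~~ (2 %| z * z')%Z by rewrite (@Euclid_dvdzM 2) // negb_or z2.
    have [q eq2] : exists q : int, p2%:Z = 4 * q + 1.
      by exists (p2 %/ 4)%N%:Z; move: m2; clear; lia.
    rewrite eq2.
    have -> : (4 * q + 1) * z * z' - 1 = 4 * (q * (z * z')) + (z * z') - 1 by ring.
    have -> : (4 * q + 1) * z * - z' - 1 = 4 * - (q * (z * z')) - (z * z') - 1 by ring.
    by move: (q * (z * z')) (z * z') zz; clear; lia.
  - exact: (sqrt_alpha_redei_field pr1 pr2 m1 m2 sol sol' z_p2 h).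
  - apply: (sqrt_alpha_redei_field pr1 pr2 m1 m2 sol _ z_p2 h).
    by case: sol' => e g h2 h4; split; rewrite ?sqrrN ?gcdzN.
have [P [PP res]] := splits_residue_int r_pr spl.
rewrite -/(redei_field p1 p2 x' y') in PP res.
have [[[PO P0 PD PM] P1 _] Pint] := PP.
set al := redei_alpha p1 x y; set K := redei_field p1 p2 x' y' in rf PP res PO PM *.
have KI n : integers_of K n%:~R by apply: intring_int.
have r12 : (sqrtC p1%:R : algC) ^+ 2 = p1%:R by apply: sqrtCK.
have Or1 : integers_of K (sqrtC p1%:R).
  split; first by apply: Qadjoin_gen; rewrite !inE eqxx.
  apply: (@Aint_quartic 0 (- p1%:Z) 0 0).
  by rewrite mulrNz -pmulrn; move: (sqrtC p1%:R) r12 => r1 <-; ring.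
have ral : sqrtC al ^+ 2 = al by apply: sqrtCK.
have Oral : integers_of K (sqrtC al).
  (* The quartic is (T^2 - x)^2 - p1 y^2. *)
  split=> //; apply: (@Aint_quartic 0 (- (2 * x)) 0 (x ^+ 2 - p1%:Z * y ^+ 2)).
  have -> : sqrtC al ^+ 4 = sqrtC al ^+ 2 * sqrtC al ^+ 2 by ring.
  rewrite ral !mulrNz intrB !expr2 !intrM -pmulrn /al /redei_alpha.
  by move: (sqrtC p1%:R) r12 => r1; rewrite expr2 => <-; ring.
have [e he] := res _ Or1; have [c hc] := res _ Oral.
exists e, c; split; apply/Pint.
- have -> : (e ^+ 2 - p1%:Z)%:~R = - (sqrtC p1%:R + e%:~R) * (sqrtC p1%:R - e%:~R) :> algC.
    by rewrite intrB !expr2 intrM -pmulrn; move: (sqrtC p1%:R) r12 => r1 <-; ring.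
  apply: PM => //; have -> : - (sqrtC p1%:R + e%:~R) = (-1)%:~R * (sqrtC p1%:R + e%:~R) :> algC
    by ring.
  by apply: intringM => //; apply: intringD.
have -> : (x + y * e - c ^+ 2)%:~R = (- y)%:~R * (sqrtC p1%:R - e%:~R)
   + (sqrtC al + c%:~R) * (sqrtC al - c%:~R) :> algC.
  have -> : (sqrtC al + c%:~R) * (sqrtC al - c%:~R) = sqrtC al ^+ 2 - c%:~R ^+ 2 by ring.
  by rewrite ral /al /redei_alpha !expr2 !(intrB, intrD, intrM, mulrNz); ring.
apply: PD; apply: PM => //.
exact: intringD.
Qed.

(** * The congruences modulo 4 *)

Lemma legendre1_sqrt (a p : nat) : legendre a p = 1 ->
  exists t : int, (p%:Z %| t ^+ 2 - a%:Z)%Z.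
Proof.
rewrite /legendre; case: ifP => // _; case: ifP => // /existsP[x /eqP ex] _.
exists x%:Z; rewrite -eqz_mod_dvd; apply/eqP.
by have := congr1 Posz ex; rewrite -!modz_nat => ->.
Qed.

Lemma natr_1mod4 (p : nat) : (p = 1 %[mod 4])%N ->
  exists c : int, p%:R = 4%:R * c%:~R + 1 :> algC.
Proof.
move=> p4; exists (p %/ 4)%N.
have e : p%:Z = 4 * (p %/ 4)%N%:Z + 1 by move: p4; clear; lia.
by rewrite [LHS]pmulrn e intrD intrM.
Qed.

Section Conclusion.
Variables (p1 p2 p3 : nat) (x y z : int).
Hypotheses (pr1 : prime p1) (m1 : (p1 = 5 %[mod 8])%N).
Hypothesis k_class1 : class_number (Qadjoin [:: sqrtC p1%:R]) 1.
Local Notation k := (Qadjoin [:: sqrtC p1%:R]).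
Local Notation Ok := (integers_of k).
Local Notation alpha := (redei_alpha p1 x y).

Lemma sqrt_zomega : sqrtC p1%:R = zomega p1 (-1) 2.
Proof. by rewrite /zomega /quad_omega; field. Qed.

Lemma redei_alpha_zomega : alpha = zomega p1 (x - y) (2 * y).
Proof. by rewrite /redei_alpha /zomega /quad_omega intrB intrM; field. Qed.

Lemma redei_alpha_norm : zomega_norm p1 (x - y) (2 * y) = x ^+ 2 - p1%:Z * y ^+ 2.
Proof.
have -> : p1%:Z = 4 * quad_const p1 + 1 by rewrite /quad_const; move: m1; clear; lia.
by rewrite /zomega_norm; ring.
Qed.

(** p2^m lies in P2^m = (alpha), so N(alpha) = p2 z^2 divides p2^(2m). *)
Lemma prime_dvd_redei_z (P2 : set algC) (m : nat) : prime p2 ->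
  redei_solution p1 p2 x y z -> prime_over Ok P2 p2 ->
  principal Ok alpha = idealX Ok P2 m ->
  forall l, prime l -> (l%:Z %| z)%Z -> l = p2.
Proof.
move=> pr2 [exyz _ _ _] [_ Pint] eP l l_pr lz.
have : idealX Ok P2 m (p2%:R ^+ m).
  elim: (m) => [|n IH]; first exact: intring1.
  exists [:: (p2%:R, p2%:R ^+ n)]; last by rewrite big_seq1 exprS.
  by move=> u; rewrite mem_seq1 => /eqP ->; split=> //; apply/(Pint p2%:Z).
rewrite -eP => -[c Oc ec]; have [c1 [c2 ecc]] := OkP pr1 m1 Oc.
have : zomega p1 (p2%:Z ^+ m) 0 = zomega p1 c1 c2 * zomega p1 (x - y) (2 * y).
  by rewrite -redei_alpha_zomega -ecc -ec /zomega mul0r addr0 rmorphXn.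
rewrite (zomM m1) => /(zom_inj pr1)[h1 h2].
have : (l%:Z %| zomega_norm p1 (p2%:Z ^+ m) 0)%Z.
  rewrite h1 h2 znormM redei_alpha_norm.
  have -> : x ^+ 2 - p1%:Z * y ^+ 2 = p2%:Z * z * z by move: exyz; clear; lia.
  by rewrite mulrA dvdz_mull.
have -> : zomega_norm p1 (p2%:Z ^+ m) 0 = (p2%:Z ^+ m) ^+ 2 by rewrite /zomega_norm; ring.
rewrite Euclid_dvdzX2 // dvdzE abszX Euclid_dvdX //= dvdn_prime2 //.
by case/andP => /eqP.
Qed.

Lemma Qadjoin_denominator X : k X -> exists2 N : int, N != 0 & Ok (N%:~R * X).
Proof.
case/Qadjoin_sqrtP=> a [b ->]; exists (denq a * denq b).
  by rewrite mulf_neq0 ?denq_neq0.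
have -> : (denq a * denq b)%:~R * (ratr a + ratr b * sqrtC p1%:R) =
  (numq a * denq b)%:~R + (numq b * denq a)%:~R * zomega p1 (-1) 2.
  rewrite -sqrt_zomega !intrM /ratr.
  have ha : (denq a)%:~R != 0 :> algC by rewrite intr_eq0 denq_neq0.
  have hb : (denq b)%:~R != 0 :> algC by rewrite intr_eq0 denq_neq0.
  by field; rewrite ha hb.
by apply: intringD; [|apply: intringM; [|exact: (Ok_zom m1)]]; apply: intring_int.
Qed.

Lemma primitive_solution : is_rel_norm p1 p3 alpha ->
  exists X Y Z, [/\ Ok X, Ok Y & Ok Z] /\ X ^+ 2 - p3%:R * Y ^+ 2 - alpha * Z ^+ 2 = 0 /\
    exists a b c, [/\ Ok a, Ok b, Ok c & a * X + b * Y + c * Z = 1].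
Proof.
case=> X0 [Y0 [kX kY e]].
have [M M0 OM1] := Qadjoin_denominator kX; have [N N0 ON1] := Qadjoin_denominator kY.
pose X1 := (M * N)%:~R * X0; pose Y1 := (M * N)%:~R * Y0; pose Z1 : algC := (M * N)%:~R.
have OX1 : Ok X1.
  have -> : X1 = N%:~R * (M%:~R * X0) by rewrite /X1 intrM; ring.
  by apply: intringM => //; apply: intring_int.
have OY1 : Ok Y1.
  have -> : Y1 = M%:~R * (N%:~R * Y0) by rewrite /Y1 intrM; ring.
  by apply: intringM => //; apply: intring_int.
have OZ1 : Ok Z1 by apply: intring_int.
have Z10 : Z1 != 0 by rewrite intr_eq0 mulf_neq0.
have e1 : X1 ^+ 2 - p3%:R * Y1 ^+ 2 - alpha * Z1 ^+ 2 = 0.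
  by rewrite e /X1 /Y1 -/Z1; ring.
have [|d [X [Y [Z [a [b [c [[Od OX OY OZ] [[Oa Ob Oc] [d0 eX eY eZ e11]]]]]]]]]] :=
    bezout3 k_class1 OX1 OY1 OZ1.
  by case=> _ _ h; rewrite h eqxx in Z10.
exists X, Y, Z; split=> //; split; last by exists a, b, c.
have d20 : d ^+ 2 != 0 by rewrite expf_neq0.
by apply: (mulIf d20); rewrite mul0r -[RHS]e1 eX eY eZ; ring.
Qed.

Lemma Ok1_not_even W : Ok W -> 1 <> 2%:R * W.
Proof.
case/(OkP pr1 m1) => a [b ->] e.
have : zomega p1 1 0 = zomega p1 (2 * a) (2 * b).
  by rewrite /zomega !intrM mul0r addr0 [LHS]e /zomega; ring.
by case/(zom_inj pr1) => h _; move: h; clear; lia.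
Qed.

(** Serves both alternatives: r = sqrt p3 with V = Y, and r = sqrt alpha with V = Z. As theta = (1 +
    r) / 2 is integral, V r = - V + 4 V' theta, so r disappears modulo 4 and lambda can be found in
    O_k. *)
Lemma unit_scaled_congruence (s' : seq algC) (r X V V' : algC) :
  sqrtC p1%:R \in s' -> r \in s' -> (1 + r) / 2%:R \in Aint ->
  Ok X -> Ok V' -> V = 2%:R * V' -> ~ (exists2 W, Ok W & X - V = 2%:R * W) ->
  exists u u', [/\ Ok u, Ok u', u * u' = 1 & exists2 lambda, integers_of (Qadjoin s') lambda &
    congr_mod (integers_of (Qadjoin s')) 4 (lambda ^+ 2) (u * X + u * V * r)].
Proof.
move=> s1 sr Ath OX OV' eV nXV.
have sub W : Ok W -> integers_of (Qadjoin s') W.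
  case=> kW AW; split=> //; move: kW; apply: Qadjoin_sub => t; rewrite mem_seq1 => /eqP ->.
  exact: Qadjoin_gen.
have OXV : Ok (X - V) by apply: intringB => //; rewrite eV; apply: intringM => //;
  apply: (intring_int 2).
have [u [u' [l [mu [[Ou Ou' Ol Omu] [uu el]]]]]] := unit_mul_square_mod4 pr1 m1 k_class1 OXV nXV.
exists u, u'; split=> //; exists l; first exact: sub.
exists (mu - u * V' * ((1 + r) / 2%:R)).
  have [k1 A1] := sub _ Omu; have [k2 A2] := sub _ Ou; have [k3 A3] := sub _ OV'.
  split; last by rewrite rpredB // rpredM // rpredM.
  apply: QadjoinB => //; apply: QadjoinM; first exact: QadjoinM.
  apply: Qadjoin_div; last exact: Qadjoin_nat.
  by apply: QadjoinD; [apply: Qadjoin1|apply: Qadjoin_gen].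
have -> : l ^+ 2 - (u * X + u * V * r) = (l ^+ 2 - u * (X - V)) - u * V * (1 + r) by ring.
by rewrite el eV; field.
Qed.

Lemma half_sqrt_prime_Aint : (p3 = 1 %[mod 4])%N -> (1 + sqrtC p3%:R) / 2%:R \in Aint.
Proof.
move=> /natr_1mod4[c e3].
have r2 : (sqrtC p3%:R : algC) ^+ 2 = 4%:R * c%:~R + 1 by rewrite sqrtCK.
apply: (@Aint_quartic (-1) (- c) 0 0).
move: (sqrtC p3%:R) r2 => r r2; set th := (1 + r) / 2%:R.
have th2 : th ^+ 2 = th + c%:~R.
  have -> : th ^+ 2 = (1 + 2%:R * r + r ^+ 2) / 4%:R by rewrite /th; field.
  by rewrite r2 /th; field.
have -> : th ^+ 4 = th ^+ 2 * th ^+ 2 by ring.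
by have -> : th ^+ 3 = th ^+ 2 * th by [ring|]; rewrite !th2; ring.
Qed.

(** On the basis (1, omega) alpha is (x - y) + 2 y omega, and the parity conditions of a solution
    say exactly that this is 1 mod 4. *)
Lemma redei_alpha_1mod4 : redei_solution p1 p2 x y z ->
  exists a b : int, alpha = 1 + 4%:R * zomega p1 a b.
Proof.
case=> _ _ /dvdzP[b eb] xy; exists ((x - y - 1) %/ 4)%Z, b.
set a := (_ %/ _)%Z; rewrite redei_alpha_zomega.
have -> : x - y = 4 * a + 1 by rewrite /a; move: xy; clear; lia.
by rewrite eb /zomega !(intrD, intrM); ring.
Qed.

Lemma half_sqrt_alpha_Aint : redei_solution p1 p2 x y z -> (1 + sqrtC alpha) / 2%:R \in Aint.
Proof.
move=> sol; have [a [b ea]] := redei_alpha_1mod4 sol.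
(* If alpha = 1 + 4 beta, then (1 + sqrt alpha) / 2 is a root of T^2 - T - beta; the quartic is the
   norm (T^2 - T)^2 - Tr(beta) (T^2 - T) + N(beta), with Tr(beta) = 2a + b. *)
apply: (@Aint_quartic (-2) (1 - (2 * a + b)) (2 * a + b) (zomega_norm p1 a b)).
have : sqrtC alpha ^+ 2 = 1 + 4%:R * zomega p1 a b by rewrite sqrtCK.
move: (sqrtC alpha) => r r2; set th := (1 + r) / 2%:R; set be := zomega p1 a b in r2.
have th2 : th ^+ 2 = th + be.
  have -> : th ^+ 2 = (1 + 2%:R * r + r ^+ 2) / 4%:R by rewrite /th; field.
  by rewrite r2 /th; field.
have e : be * ((2 * a + b)%:~R - be) = (zomega_norm p1 a b)%:~R.
  rewrite -(zom_conj m1) /be; congr (_ * _); rewrite /zomega !(intrD, intrM, mulrNz); ring.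
rewrite -e; have -> : th ^+ 4 = th ^+ 2 * th ^+ 2 by ring.
have -> : th ^+ 3 = th + be + be * th.
  have -> : th ^+ 3 = th ^+ 2 * th by ring.
  by rewrite th2 mulrDl -expr2 th2.
rewrite th2; have -> : (th + be) * (th + be) = th ^+ 2 + 2%:R * be * th + be ^+ 2 by ring.
by rewrite th2 intrB; ring.
Qed.

(** Modulo 4 the equation is X^2 = Y^2 + Z^2. So (X - Y - Z)^2 is even, and X = Y + Z + 2R as 2 is
    prime; inserting this gives 4 | 2 Y Z, and 2 divides Y or Z. *)
Lemma solution_parity X Y Z : (p3 = 1 %[mod 4])%N -> redei_solution p1 p2 x y z ->
  Ok X -> Ok Y -> Ok Z -> X ^+ 2 - p3%:R * Y ^+ 2 - alpha * Z ^+ 2 = 0 ->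
  (exists2 R, Ok R & X = Y + Z + 2%:R * R) /\
  ((exists2 Y', Ok Y' & Y = 2%:R * Y') \/ (exists2 Z', Ok Z' & Z = 2%:R * Z')).
Proof.
move=> m3 sol OX OY OZ e; have [a [b ea]] := redei_alpha_1mod4 sol.
have [c e3] := natr_1mod4 m3; pose be := zomega p1 a b.
have Obe : Ok be by apply: (Ok_zom m1).
pose W := c%:~R * (Y * Y) + be * (Z * Z).
have OW : Ok W by apply: intringD; apply: intringM;
  [apply: intring_int|apply: intringM|exact: Obe|apply: intringM].
have eW : X ^+ 2 = Y ^+ 2 + Z ^+ 2 + 4%:R * W.
  by apply/eqP; rewrite -subr_eq0 -[X in _ == X]e e3 ea -/be /W; apply/eqP; ring.
have O2 t : Ok t -> Ok (2%:R * t) by move=> Ot; apply: intringM => //; apply: (intring_int 2).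
have [R OR eR] : exists2 R, Ok R & X - Y - Z = 2%:R * R.
  have OD : Ok (X - Y - Z) by apply: intringB => //; apply: intringB.
  have [||//|//] := @Ok_even_mul p1 pr1 m1 (X - Y - Z) (X - Y - Z)
     (2%:R * W + Y * Y + Z * Z + Y * Z - X * Y - X * Z) OD OD.
  - do 2 (apply: intringB; last by apply: intringM).
    by do 3 (apply: intringD; last by apply: intringM); apply: O2.
  - have -> : (X - Y - Z) * (X - Y - Z) =
      X ^+ 2 + Y ^+ 2 + Z ^+ 2 + 2%:R * (Y * Z - X * Y - X * Z) by ring.
    by rewrite eW; ring.
have eX : X = Y + Z + 2%:R * R by rewrite -eR; ring.
split; first by exists R.
apply: (@Ok_even_mul p1 pr1 m1 _ _ (W - R * Y - R * Z - R * R)) => //.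
  by do 3 (apply: intringB; last by apply: intringM).
apply: (mulfI (_ : 2%:R != 0)); first by rewrite pnatr_eq0.
move: eW; rewrite eX => eW.
have -> : 2%:R * (Y * Z) = (Y + Z + 2%:R * R) ^+ 2 - (Y ^+ 2 + Z ^+ 2)
  - 4%:R * (R * Y + R * Z + R * R) by ring.
by rewrite eW; ring.
Qed.
End Conclusion.

Theorem theorem3p1p6 (p1 p2 p3 : nat)
  (p_uniq : uniq [:: p1; p2; p3])
  (p_prime : forall p, p \in [:: p1; p2; p3] -> prime p)
  (p_mod4 : forall p, p \in [:: p1; p2; p3] -> (p = 1 %[mod 4])%N)
  (p_legendre : forall p q, p \in [:: p1; p2; p3] -> q \in [:: p1; p2; p3] ->
     p != q -> legendre p q = 1)
  (p_redei : forall p q r, perm_eq [:: p; q; r] [:: p1; p2; p3] ->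
     redei_symbol p q r = 1)
  (P2 : set algC) (x y z : int) (m : nat)
  (k := Qadjoin [:: sqrtC p1%:R])
  (Ok := integers_of k)
  (alpha := redei_alpha p1 x y)
  (Ok13 := integers_of (Qadjoin [:: sqrtC p1%:R; sqrtC p3%:R]))
  (Ok13' := integers_of (Qadjoin [:: sqrtC p1%:R; sqrtC alpha]))
  (P2_over : prime_over Ok P2 p2)
  (xyz_sol : redei_solution p1 p2 x y z)
  (m_odd : odd m)
  (alpha_P2 : principal Ok alpha = idealX Ok P2 m)
  (k_class1 : class_number k 1)
  (p1_mod8 : (p1 = 5 %[mod 8])%N) :
  exists X Y Z : algC,
    [/\ Ok X, Ok Y & Ok Z] /\
    [/\ X ^+ 2 - p3%:R * Y ^+ 2 - alpha * Z ^+ 2 = 0,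
        gcd3_eq1 Ok X Y Z
      & (coprime_ideals Ok (principal Ok Z) (principal Ok 2) /\
         exists2 lambda, Ok13 lambda &
           congr_mod Ok13 4 (lambda ^+ 2) (X + Y * sqrtC p3%:R))
        \/
        (coprime_ideals Ok (principal Ok Y) (principal Ok 2) /\
         exists2 lambda, Ok13' lambda &
           congr_mod Ok13' 4 (lambda ^+ 2) (X + Z * sqrtC alpha))].
Proof.
have in1 : p1 \in [:: p1; p2; p3] by rewrite !inE eqxx.
have in2 : p2 \in [:: p1; p2; p3] by rewrite !inE eqxx orbT.
have in3 : p3 \in [:: p1; p2; p3] by rewrite !inE eqxx !orbT.
have pr1 := p_prime _ in1; have pr2 := p_prime _ in2; have pr3 := p_prime _ in3.
have m1 := p_mod4 _ in1; have m2 := p_mod4 _ in2; have m3 := p_mod4 _ in3.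
have [n13 n23] : p1 != p3 /\ p2 != p3.
  by move: p_uniq; rewrite /= !inE negb_or => /andP[/andP[_ ->]]; rewrite andbT => ->.
have n31 : p3 != p1 by rewrite eq_sym.
have n32 : p3 != p2 by rewrite eq_sym.
have sq31 := legendre1_sqrt (p_legendre _ _ in3 in1 n31).
have sq32 := legendre1_sqrt (p_legendre _ _ in3 in2 n32).
have z_p2 := prime_dvd_redei_z pr1 p1_mod8 pr2 xyz_sol P2_over alpha_P2.
have [e [c [he hc]]] := redei_symbol_residues pr1 pr2 pr3 m1 m2 xyz_sol z_p2
  (p_redei _ _ _ (perm_refl _)).
(* A solution for the pair (p3, p2) is part of what [p3, p2, p1] = 1 asserts. *)
have [u [v [w [euvw guvw _ _]]]] : exists u v w, redei_solution p3 p2 u v w.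
  have /p_redei : perm_eq [:: p3; p2; p1] [:: p1; p2; p3] by rewrite -perm_rev.
  rewrite /redei_symbol; case: asboolP => // -[u [v [w [sol _]]]] _.
  by exists u, v, w.
have [exyz _ _ _] := xyz_sol.
have Nal := redei_alpha_rel_norm pr1 pr2 pr3 n13 n23 p1_mod8 m3 sq31 sq32 exyz z_p2
  euvw guvw he hc.
have [X [Y [Z [[OX OY OZ] [eq0 [a [b [d [Oa Ob Od e1]]]]]]]]] :=
  primitive_solution p1_mod8 k_class1 Nal.
have [[R OR eX] YZ] := solution_parity pr1 p1_mod8 m3 xyz_sol OX OY OZ eq0.
(* If Y and Z were both even, so would be X = Y + Z + 2R, against the Bezout relation. *)
have notboth : ~ ((exists2 Y', Ok Y' & Y = 2%:R * Y') /\ (exists2 Z', Ok Z' & Z = 2%:R * Z')).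
  case=> -[Y' OY' eY] [Z' OZ' eZ].
  apply: (Ok1_not_even pr1 p1_mod8 (W := a * (Y' + Z' + R) + b * Y' + d * Z')).
    by do ![apply: intringD|apply: intringM].
  by rewrite -[LHS]e1 eX eY eZ; ring.
(* Modulo 2, X - Y is Z and X - Z is Y; subtracting the even one of Y and Z from X thus leaves an
   element not divisible by 2. *)
have shift V W : Ok V -> X - V = W + 2%:R * R -> ~ (exists2 W', Ok W' & W = 2%:R * W') ->
    ~ (exists2 W', Ok W' & X - V = 2%:R * W').
  move=> OV eV nW [W' OW' eW']; apply: nW; exists (W' - R); first exact: intringB.
  by rewrite mulrBr -eW' eV; ring.
(* The square modulo 4 appears only after multiplication by a unit, so the whole solution is
   scaled. *)
have scaled g g' : Ok g -> Ok g' -> g * g' = 1 ->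
  [/\ [/\ Ok (g * X), Ok (g * Y) & Ok (g * Z)],
      (g * X) ^+ 2 - p3%:R * (g * Y) ^+ 2 - alpha * (g * Z) ^+ 2 = 0,
      gcd3_eq1 Ok (g * X) (g * Y) (g * Z) &
      forall W, Ok W -> ~ (exists2 W', Ok W' & W = 2%:R * W') ->
        coprime_ideals Ok (principal Ok (g * W)) (principal Ok 2)].
  move=> Og Og' gg; split.
  - by split; apply: intringM.
  - by rewrite -[RHS](mulr0 (g ^+ 2)) -eq0 -/alpha; ring.
  - move=> h Oh [A OA eA] [B OB eB] [C OC eC].
    exists (g' * (a * A + b * B + d * C)); first by apply: intringM => //;
      do ![apply: intringD|apply: intringM].
    have -> : g' * (a * A + b * B + d * C) * h = g' * (a * (A * h) + b * (B * h) + d * (C * h))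
      by ring.
    rewrite -eA -eB -eC.
    have -> : g' * (a * (g * X) + b * (g * Y) + d * (g * Z)) = g * g' * (a * X + b * Y + d * Z)
      by ring.
    by rewrite e1 gg mulr1.
  - move=> W OW nW; apply: (Ok_coprime2 pr1 p1_mod8); first exact: intringM.
    case=> W' OW' eW'; apply: nW; exists (g' * W'); first exact: intringM.
    by rewrite mulrCA -eW' mulrA [g' * g]mulrC gg mul1r.
have [[Y' OY' eY]|nY] := pselect (exists2 Y', Ok Y' & Y = 2%:R * Y').
  have nZ : ~ (exists2 Z', Ok Z' & Z = 2%:R * Z').
    by move=> hZ; apply: notboth; split=> //; exists Y'.
  have nXY : ~ (exists2 W, Ok W & X - Y = 2%:R * W).
    by apply: (shift Y Z) => //; rewrite eX; ring.
  have [||g [g' [Og Og' gg hl]]] := unit_scaled_congruence (s' := [:: sqrtC p1%:R; sqrtC p3%:R])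
    pr1 p1_mod8 k_class1 _ _ (half_sqrt_prime_Aint m3) OX OY' eY nXY.
  - by rewrite !inE eqxx.
  - by rewrite !inE eqxx orbT.
  have [Os e0 g1 cop] := scaled _ _ Og Og' gg.
  by exists (g * X), (g * Y), (g * Z); split=> //; split=> //; left; split=> //; apply: cop.
have [//|[Z' OZ' eZ]] := YZ.
have nXZ : ~ (exists2 W, Ok W & X - Z = 2%:R * W).
  by apply: (shift Z Y) => //; rewrite eX; ring.
have [||g [g' [Og Og' gg hl]]] := unit_scaled_congruence (s' := [:: sqrtC p1%:R; sqrtC alpha])
  pr1 p1_mod8 k_class1 _ _ (half_sqrt_alpha_Aint p1_mod8 xyz_sol) OX OZ' eZ nXZ.
- by rewrite !inE eqxx.
- by rewrite !inE eqxx orbT.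
have [Os e0 g1 cop] := scaled _ _ Og Og' gg.
by exists (g * X), (g * Y), (g * Z); split=> //; split=> //; right; split=> //; apply: cop.
Qed.
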